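(* Let $k$ be any field (no restriction on its characteristic) and let $(G,V)$ be either (a) $G=\mathrm{GL}_3\times\mathrm{GL}_3\times\mathrm{GL}_2$, $V=\{(x_1,x_2):x_i\in M_3\}$, $F_x(v)=\det(v_1x_1+v_2x_2)$; or (b) $G=\mathrm{GL}_6\times\mathrm{GL}_2$, $V=\{(x_1,x_2)\}$ pairs of $6\times6$ alternating matrices with zero diagonal, $F_x(v)=\mathrm{Pfaff}(v_1x_1+v_2x_2)$. Let $V^{ss}=\{x\in V:\ \mathrm{disc}(F_x)\neq0\}$. For $x\in V^{ss}(k)$ let $\gamma_V(x)\in\mathrm{Ex}_3(k)$ be the class of the homomorphism $\mathrm{Gal}(k^{\mathrm{sep}}/k)\to\mathfrak S_3$ given by the Galois action on the three distinct zeros of the binary cubic form $F_x$ in $\mathbb P^1(k^{\mathrm{sep}})$. Then $\gamma_V$ induces a bijection $G(k)\backslash V^{ss}(k)\to\mathrm{Ex}_3(k)$.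
   Context: Actions: in case (a), $(g_1,g_2,g_3)$ sends $x_i\mapsto g_1x_i\,{}^tg_2$ and then $g_3\in\mathrm{GL}_2$ acts on the pair $(x_1,x_2)$ as a column vector; in case (b), $g_1$ acts by $x_i\mapsto g_1x_i\,{}^tg_1$ and $g_2$ acts on the pair as a column vector. $F_x(v)$ is a binary cubic form in $v=(v_1,v_2)$; $\mathrm{disc}$ is its discriminant. $\mathrm{Ex}_3(k)$ is the set of conjugacy classes of homomorphisms $\mathrm{Gal}(k^{\mathrm{sep}}/k)\to\mathfrak S_3$. *)

(* Defs.v *)
From HB Require Import structures.
From mathcomp Require Import all_boot all_order all_algebra all_fingroup all_field.
From mathcomp Require Import boolp classical_sets functions.
From mathcomp.multinomials Require Import mpoly.

Set Implicit Arguments.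
Unset Strict Implicit.
Unset Printing Implicit Defensive.

Import GRing.Theory.

Local Open Scope ring_scope.
Local Open Scope quotient_scope.
Local Open Scope classical_set_scope.

Definition separably_closed (K : fieldType) : Prop :=
  forall p : {poly K}, separable_poly p -> (1 < size p)%N ->
    exists a, root p a.

Definition separable_algebraic (k K : fieldType) (iota : {rmorphism k -> K}) :
    Prop :=
  forall a : K, exists p : {poly k},
    separable_poly p /\ root (map_poly iota p) a.

Definition separable_closure (k K : fieldType) (iota : {rmorphism k -> K}) :
    Prop :=
  separable_algebraic iota /\ separably_closed K.

Section Galois.
Variables (k K : fieldType) (iota : {rmorphism k -> K}).

Definition is_absgal (f : K -> K) : Prop :=
  [/\ zmod_morphism f, GRing.monoid_morphism f, bijective f
    & forall a, f (iota a) = iota a].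

Record absgal := AbsGal { absgal_fun :> K -> K; absgalP : is_absgal absgal_fun }.

HB.instance Definition _ := gen_eqMixin absgal.
HB.instance Definition _ := gen_choiceMixin absgal.

HB.instance Definition _ (s : absgal) :=
  GRing.isZmodMorphism.Build K K (absgal_fun s)
    (let: And4 h _ _ _ := absgalP s in h).
HB.instance Definition _ (s : absgal) :=
  GRing.isMonoidMorphism.Build K K (absgal_fun s)
    (let: And4 _ h _ _ := absgalP s in h).

Lemma absgal_eqP (s t : absgal) : absgal_fun s =1 absgal_fun t -> s = t.
Proof.
case: s t => [f fP] [g gP] /= /funext eq_fg.
by rewrite eq_fg in fP *; congr AbsGal; apply: Prop_irrelevance.
Qed.

Lemma absgal_bij (s : absgal) : bijective s.
Proof. by case: (absgalP s). Qed.

Lemma absgal_iota (s : absgal) a : s (iota a) = iota a.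
Proof. by case: (absgalP s). Qed.

Fact absgal_one_subproof : is_absgal idfun.
Proof. by split=> //; exists idfun. Qed.

Definition absgal_one := AbsGal absgal_one_subproof.

Fact absgal_mul_subproof (s t : absgal) : is_absgal (t \o s).
Proof.
split.
- by move=> a b /=; rewrite !rmorphB.
- by split=> [|a b] /=; rewrite ?rmorph1 ?rmorphM.
- exact: bij_comp (absgal_bij t) (absgal_bij s).
- by move=> a /=; rewrite !absgal_iota.
Qed.

Definition absgal_mul s t := AbsGal (absgal_mul_subproof s t).

Fact absgal_inv_ex (s : absgal) : exists t : absgal, cancel s t /\ cancel t s.
Proof.
have [g sK gK] := absgal_bij s.
have gP : is_absgal g.
  split.
  - by move=> a b; apply: (can_inj sK); rewrite rmorphB /= !gK.
  - split=> [|a b]; first by rewrite -[X in g X](rmorph1 s) sK.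
    by apply: (can_inj sK); rewrite rmorphM /= !gK.
  - by exists (absgal_fun s).
  - by move=> a; rewrite -{1}(absgal_iota s a) sK.
by exists (AbsGal gP).
Qed.

Definition absgal_inv (s : absgal) : absgal := projT1 (cid (absgal_inv_ex s)).

Fact absgal_mulA : associative absgal_mul.
Proof. by move=> s t u; apply: absgal_eqP. Qed.

Fact absgal_mul1 : left_id absgal_one absgal_mul.
Proof. by move=> s; apply: absgal_eqP. Qed.

Fact absgal_mulr1 : right_id absgal_one absgal_mul.
Proof. by move=> s; apply: absgal_eqP. Qed.

Fact absgal_mulV : left_inverse absgal_one absgal_inv absgal_mul.
Proof.
move=> s; apply: absgal_eqP => a /=; rewrite /absgal_inv.
by case: cid => t /= [_ tK]; rewrite tK.
Qed.

Fact absgal_mulrV : right_inverse absgal_one absgal_inv absgal_mul.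
Proof.
move=> s; apply: absgal_eqP => a /=; rewrite /absgal_inv.
by case: cid => t /= [sK _]; rewrite sK.
Qed.

(* As for permutations and for galM, (s * t) a = t (s a). *)
HB.instance Definition _ := isGroup.Build absgal
  absgal_mulA absgal_mul1 absgal_mulr1 absgal_mulV absgal_mulrV.

(* The automorphisms agreeing with s on a finite subset of K form a           *)
(* neighbourhood basis of s for the Krull topology; 'S_3 is discrete.         *)
Definition krull_continuous (rho : absgal -> 'S_3) : Prop :=
  forall s : absgal, exists e : seq K,
    forall t : absgal, {in e, t =1 s} -> rho t = rho s.

Definition absgal_hom : set (absgal -> 'S_3) :=
  [set rho : absgal -> 'S_3 |
    {morph rho : s t / (s * t)%g >-> (s * t)%g} /\ krull_continuous rho].

Definition hom_class (rho : absgal -> 'S_3) : set (absgal -> 'S_3) :=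
  [set (fun s => (rho s ^ u)%g) | u in [set: 'S_3]].

Definition Ex3 : set (set (absgal -> 'S_3)) :=
  [set hom_class rho | rho in absgal_hom].

End Galois.

Arguments absgal_hom {k K} iota.
Arguments Ex3 {k K} iota.

Section ProjectiveLine.
Variable K : fieldType.

Definition P1rep := {v : 'rV[K]_2 | v != 0}.

Definition P1eq (v w : P1rep) : bool := (val v == val w)%MS.

Fact P1eq_equiv : equiv_class_of P1eq.
Proof.
split=> [v|v w|w v u]; rewrite /P1eq.
- exact/eqmxP.
- by rewrite andbC.
- by move=> /eqmxP vw /eqmxP wu; apply/eqmxP; apply: eqmx_trans vw wu.
Qed.

Canonical P1eq_equiv_rel := EquivRelPack P1eq_equiv.

Definition P1 := {eq_quot P1eq_equiv_rel}.

End ProjectiveLine.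

Section GaloisOnP1.
Variables (k K : fieldType) (iota : {rmorphism k -> K}).

Fact absgal_rep_subproof (s : absgal iota) (v : P1rep K) : map_mx s (val v) != 0.
Proof. by rewrite map_mx_eq0; apply: (valP v). Qed.

Definition absgal_rep (s : absgal iota) (v : P1rep K) : P1rep K :=
  Sub (map_mx s (val v)) (absgal_rep_subproof s v).

Definition absgal_P1 (s : absgal iota) (p : P1 K) : P1 K :=
  \pi_(P1 K) (absgal_rep s (generic_quotient.repr p)).

(* For homogeneous F the condition does not depend on the representative. *)
Definition P1_zeros (F : {mpoly k[2]}) : set (P1 K) :=
  [set p : P1 K |
    (map_mpoly iota F).@[fun i => val (generic_quotient.repr p) ord0 i] = 0].

(* All the homomorphisms obtained from the Galois action on the three zeros,  *)
(* one for each labelling z of the zeros: a full conjugacy class when F is a  *)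
(* cubic form with three distinct zeros.                                      *)
Definition gamma (F : {mpoly k[2]}) : set (absgal iota -> 'S_3) :=
  [set rho : absgal iota -> 'S_3 |
    exists2 z : 'I_3 -> P1 K, set_bij setT (P1_zeros F) z
    & forall s i, absgal_P1 s (z i) = z (rho s i)].

End GaloisOnP1.

Arguments P1_zeros {k K} iota F.
Arguments gamma {k K} iota F.

Section BinaryCubic.
Variable R : comNzRingType.

(* coefficient of v_1^(3-j) v_2^j *)
Definition cubic_coef (F : {mpoly R[2]}) (j : nat) : R :=
  F@_(U_(0%R) *+ (3 - j) + U_(1%R) *+ j)%MM.

Definition disc (F : {mpoly R[2]}) : R :=
  let a := cubic_coef F 0 in let b := cubic_coef F 1 in
  let c := cubic_coef F 2 in let d := cubic_coef F 3 in
  b ^+ 2 * c ^+ 2 - 4%:R * a * c ^+ 3 - 4%:R * b ^+ 3 * d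
    - 27%:R * a ^+ 2 * d ^+ 2 + 18%:R * a * b * c * d.

Definition pencil n (x : 'M[R]_n * 'M[R]_n) : 'M[{mpoly R[2]}]_n :=
  'X_0 *: map_mx (@mpolyC 2 R) x.1 + 'X_1 *: map_mx (@mpolyC 2 R) x.2.

Definition act_pair n (g : 'M[R]_2) (x : 'M[R]_n * 'M[R]_n) :
    'M[R]_n * 'M[R]_n :=
  (g 0 0 *: x.1 + g 0 1 *: x.2, g 1 0 *: x.1 + g 1 1 *: x.2).

End BinaryCubic.

Section Pfaffian.
Variables (R : comNzRingType) (n : nat).

Fact even_ord_subproof (i : 'I_n) : (i.*2 < n.*2)%N.
Proof. by rewrite ltn_double. Qed.

Fact odd_ord_subproof (i : 'I_n) : (i.*2.+1 < n.*2)%N.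
Proof. by rewrite ltn_Sdouble. Qed.

Definition even_ord i := Ordinal (even_ord_subproof i).
Definition odd_ord i := Ordinal (odd_ord_subproof i).

(* One permutation for each perfect matching {s 0, s 1}, {s 2, s 3}, ... *)
Definition matching_perm (s : 'S_n.*2) : bool :=
  [forall i : 'I_n, (s (even_ord i) < s (odd_ord i))%N] &&
  [forall i : 'I_n, forall j : 'I_n,
    (i < j)%N ==> (s (even_ord i) < s (even_ord j))%N].

Definition pfaffian (A : 'M[R]_n.*2) : R :=
  \sum_(s : 'S_n.*2 | matching_perm s)
    (-1) ^+ s * \prod_(i < n) A (s (even_ord i)) (s (odd_ord i)).

End Pfaffian.

Definition alternating (R : comNzRingType) n (A : 'M[R]_n) : Prop :=
  A^T = - A /\ forall i, A i i = 0.

Section Spaces.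
Variable k : fieldType.

Definition GL n : set 'M[k]_n := [set g | g \in unitmx].

Definition G_a : set ('M[k]_3 * 'M[k]_3 * 'M[k]_2) :=
  [set g | [/\ GL g.1.1, GL g.1.2 & GL g.2]].

Definition act_a (g : 'M[k]_3 * 'M[k]_3 * 'M[k]_2)
    (x : 'M[k]_3 * 'M[k]_3) : 'M[k]_3 * 'M[k]_3 :=
  let: (g1, g2, g3) := g in
  act_pair g3 (g1 *m x.1 *m g2^T, g1 *m x.2 *m g2^T).

Definition form_a (x : 'M[k]_3 * 'M[k]_3) : {mpoly k[2]} := \det (pencil x).

Definition Vss_a : set ('M[k]_3 * 'M[k]_3) := [set x | disc (form_a x) != 0].

Definition orbit_a x := [set act_a g x | g in G_a].

Definition G_b : set ('M[k]_6 * 'M[k]_2) := [set g | GL g.1 /\ GL g.2].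

Definition act_b (g : 'M[k]_6 * 'M[k]_2)
    (x : 'M[k]_6 * 'M[k]_6) : 'M[k]_6 * 'M[k]_6 :=
  let: (g1, g2) := g in
  act_pair g2 (g1 *m x.1 *m g1^T, g1 *m x.2 *m g1^T).

Definition form_b (x : 'M[k]_6 * 'M[k]_6) : {mpoly k[2]} :=
  @pfaffian _ 3 (pencil x).

Definition V_b : set ('M[k]_6 * 'M[k]_6) :=
  [set x | alternating x.1 /\ alternating x.2].

Definition Vss_b : set ('M[k]_6 * 'M[k]_6) :=
  [set x | V_b x /\ disc (form_b x) != 0].

Definition orbit_b x := [set act_b g x | g in G_b].

End Spaces.

Definition induces_bijection (X Y : Type) (D : set X) (orb : X -> set X)
    (h : X -> Y) (B : set Y) : Prop :=
  exists2 f : set X -> Y, (forall x, D x -> f (orb x) = h x)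
                        & set_bij [set orb x | x in D] B f.

(* Main.v *)
(**
  The three singular members of the pencil x have kernels which, over the
  separable closure K, split K^n into three summands that the Galois group
  permutes like the zeros of F_x.  Bases of the kernels computed by Gaussian
  elimination from normalised zeros are permuted as well, and in them x becomes
  block diagonal with blocks Q_i J, where J is fixed and Q_i is a linear form
  vanishing at the i-th zero.  Such a frame relative to rho exists if and only
  if rho belongs to gamma(F_x), and it is transported by the group action.  Two
  frames relative to the same rho differ by Galois-invariant matrices, because
  three points of P^1 can be moved to any other three by a unique element of
  PGL_2; by descent, x and y are then in the same orbit over k.  This argument
  does not need a rational point where F_x is nonzero, so it covers k = F_2.
  Conversely, Hilbert 90 for the permutation module of rho provides a frame,
  from which x is recovered by descent.  Descent rests on k being the fixed
  field of the automorphisms of K, which are extended by Zorn's lemma.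
*)
Require Import Defs.
From HB Require Import structures.
From mathcomp Require Import all_boot all_order all_algebra all_fingroup all_field.
From mathcomp Require Import boolp classical_sets functions.
From mathcomp.multinomials Require Import mpoly.
From mathcomp Require Import ring zify.
Set Implicit Arguments.
Unset Strict Implicit.
Unset Printing Implicit Defensive.

Import GRing.Theory.

Local Open Scope ring_scope.
Local Open Scope classical_set_scope.

(** * Automorphisms of a separable closure *)

(** Both cases are instances of one statement on [3d] by [3d] matrices: [d = 1], [J = 1] in case
    (a); [d = 2], [J] the standard symplectic matrix in case (b), where a singular alternating
    member loses rank at least 2 and one frame serves rows and columns alike. The obstacle in
    comparing two frames is a scalar: a matrix of GL_2 carries three linear forms to three others
    only up to factors e_i. These are chosen as ratios of the coefficients in the linear relations
    among the forms; Galois then permutes the e_i, and the matrix is rational. Each e_i is absorbed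
    into the frame by matrices that multiply [J] by e_i: a scalar on one side in case (a), diag(e_i,
    1) on both sides in case (b). To cover every characteristic, separability comes from Bezout
    identities with the discriminant, and alternating matrices are written T - T^T. An invertible
    member of the pencil exists over [K], because P^1(K) always has a fourth point. *)

Lemma separable_split (K : fieldType) : separably_closed K ->
  forall p : {poly K}, separable_poly p ->
  exists2 rs, uniq rs & p = lead_coef p *: \prod_(r <- rs) ('X - r%:P).
Proof.
move=> closedK p; have [n] := ubnP (size p).
elim: n p => // n IHn p ltpn sep_p.
have p_neq0 : p != 0 by apply: separable_poly_neq0.
have [size_p|size_p] := leqP (size p) 1.
  exists [::] => //; rewrite big_nil alg_polyC.
  by rewrite [LHS]size1_polyC // lead_coefE; case: (size p) size_p => [|[]].
have [a pa] := closedK p sep_p size_p.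
have /factor_theorem [q def_p] := pa.
have := sep_p; rewrite def_p separable_mul => /and3P[sep_q _].
rewrite coprimep_XsubC => nqa.
have q_neq0 : q != 0 by apply: contraNneq p_neq0; rewrite def_p => ->; rewrite mul0r.
have size_q : (size q < n)%N.
  by move: ltpn; rewrite def_p size_Mmonic ?monicXsubC // size_XsubC addn2.
have [rs uniq_rs def_q] := IHn q size_q sep_q.
exists (a :: rs).
  rewrite /= uniq_rs andbT; apply: contraNN nqa => a_rs.
  by rewrite def_q rootZ ?lead_coef_eq0 // root_prod_XsubC.
rewrite big_cons lead_coef_Mmonic ?monicXsubC // {1}def_q.
by rewrite -scalerAl mulrC.
Qed.

Lemma separable_roots (K : fieldType) : separably_closed K ->
  forall p : {poly K}, separable_poly p ->
  exists2 rs, uniq rs & forall x, root p x = (x \in rs).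
Proof.
move=> closedK p sep_p; have [rs uniq_rs def_p] := separable_split closedK sep_p.
exists rs => // x.
by rewrite def_p rootZ ?lead_coef_eq0 ?separable_poly_neq0 // root_prod_XsubC.
Qed.

Lemma size1_monic (R : nzRingType) (p : {poly R}) :
  (size p <= 1)%N -> p \is monic -> p`_0 = 1.
Proof.
by move=> size_p /monicP; rewrite lead_coefE; case: (size p) size_p => [|[]].
Qed.

Section FixedField.
Variables (k K : fieldType) (iota : {rmorphism k -> K}).
Let P := (K * K)%type.

Definition diag (a : k) : K * K := (iota a, iota a).

Fact diag_zmod_morphism : zmod_morphism diag.
Proof. by move=> a b; rewrite /diag !rmorphB. Qed.

Fact diag_monoid_morphism : GRing.monoid_morphism diag.
Proof. by split=> [|a b]; rewrite /diag ?rmorph1 ?rmorphM. Qed.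

HB.instance Definition _ := GRing.isZmodMorphism.Build k (K * K)%type diag
  diag_zmod_morphism.
HB.instance Definition _ := GRing.isMonoidMorphism.Build k (K * K)%type diag
  diag_monoid_morphism.

(* A k-embedding of a subfield of K into K is encoded by its graph, which is  *)
(* a k-subalgebra of K * K.                                                   *)
Definition graph (G : set P) : Prop :=
  [/\ forall a, G (diag a), forall x y, G x -> G y -> G (x - y),
      forall x y, G x -> G y -> G (x * y) & forall x, G x -> x.1 = 0 -> x = 0].

Definition poly_in (G : set P) (q : {poly P}) := forall i, G q`_i.

Definition adjoin (G : set P) (x : P) : set P := [set q.[x] | q in poly_in G].

Section Graph.
Variable G : set P.
Hypothesis graphG : graph G.

Let Gd a : G (diag a). Proof. by case: graphG. Qed.
Let GB x y : G x -> G y -> G (x - y). Proof. by case: graphG => _ h _ _; apply: h. Qed.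
Let GM x y : G x -> G y -> G (x * y). Proof. by case: graphG => _ _ h _; apply: h. Qed.
Let G_eq0 x : G x -> x.1 = 0 -> x = 0. Proof. by case: graphG => _ _ _; apply. Qed.

Lemma graph0 : G 0.
Proof. by have := Gd 0; rewrite rmorph0. Qed.

Lemma graph1 : G 1.
Proof. by have := Gd 1; rewrite rmorph1. Qed.

Lemma graphN x : G x -> G (- x).
Proof. by move=> Gx; rewrite -sub0r; apply: GB => //; apply: graph0. Qed.

Lemma graphD x y : G x -> G y -> G (x + y).
Proof. by move=> Gx Gy; rewrite -[y]opprK; apply: GB => //; apply: graphN. Qed.

Lemma graph_sum I r (Pr : pred I) (F : I -> P) :
  (forall i, G (F i)) -> G (\sum_(i <- r | Pr i) F i).
Proof.
by move=> GF; elim/big_ind: _ => [|x y Gx Gy|//]; [apply: graph0|apply: graphD].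
Qed.

Lemma graphX x n : G x -> G (x ^+ n).
Proof.
by move=> Gx; elim: n => [|n IHn]; [apply: graph1|rewrite exprS; apply: GM].
Qed.

Lemma graph_horner q x : poly_in G q -> G x -> G q.[x].
Proof.
move=> Gq Gx; rewrite horner_coef.
by apply: graph_sum => i; apply: GM; rewrite ?Gq //; apply: graphX.
Qed.

Lemma poly_in_diag p : poly_in G (map_poly diag p).
Proof. by move=> i; rewrite coef_map; apply: Gd. Qed.

Lemma poly_inC x : G x -> poly_in G x%:P.
Proof. by move=> Gx i; rewrite coefC; case: ifP => // _; apply: graph0. Qed.

Lemma poly_inXn n : poly_in G 'X^n.
Proof.
by move=> i; rewrite coefXn; case: (_ == _); [apply: graph1|apply: graph0].
Qed.

Lemma poly_inB p q : poly_in G p -> poly_in G q -> poly_in G (p - q).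
Proof. by move=> Gp Gq i; rewrite coefB; apply: GB. Qed.

Lemma poly_inD p q : poly_in G p -> poly_in G q -> poly_in G (p + q).
Proof. by move=> Gp Gq i; rewrite coefD; apply: graphD. Qed.

Lemma poly_inM p q : poly_in G p -> poly_in G q -> poly_in G (p * q).
Proof. by move=> Gp Gq i; rewrite coefM; apply: graph_sum => j; apply: GM. Qed.

Lemma sub_adjoin x : G `<=` adjoin G x.
Proof. by move=> y Gy; exists y%:P; rewrite ?hornerC //; apply: poly_inC. Qed.

Lemma mem_adjoin x : adjoin G x x.
Proof. by exists 'X; rewrite ?hornerX // -['X]expr1; apply: poly_inXn. Qed.

(** A ring that is algebraic over a field is a field: after cancelling powers of X, the equation of
    [x.1] reads q(x) x = -c with c a nonzero constant. It is an equation on first coordinates only,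
    and lifts to pairs by the last clause of [graph]. *)
Lemma graph_inv (alg : separable_algebraic iota) x :
  G x -> x != 0 -> exists2 y, G y & y * x = 1.
Proof.
move=> Gx x_neq0; have [p [/separable_poly_neq0 p_neq0 px]] := alg x.1.
elim/poly_ind: p p_neq0 px => [|p c IHp]; first by rewrite eqxx.
have x1 : x.1 != 0 by apply: contraNneq x_neq0 => /(G_eq0 Gx) ->.
have [-> |c_neq0 _ px] := eqVneq c 0.
  rewrite addr0 rmorphM /= map_polyX rootM mulf_eq0 negb_or.
  move=> /andP[p_neq0 _] /orP[|]; first exact: IHp.
  by rewrite /root hornerX (negPf x1).
pose q := map_poly diag p; have Gq : poly_in G q by apply: poly_in_diag.
have qx : q.[x] * x = - diag c.
  apply/eqP; rewrite -addr_eq0; apply/eqP; apply: G_eq0.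
    by apply: graphD => //; apply: GM => //; apply: graph_horner.
  have /eqP := px; rewrite rmorphD rmorphM /= map_polyX map_polyC /= hornerMXaddC.
  move=> <- /=; congr (_ * _ + _).
  by rewrite -(horner_map fst) -map_poly_comp.
exists (- diag c^-1 * q.[x]).
  by apply: GM; [apply: graphN|apply: graph_horner].
by rewrite -mulrA qx mulrNN -rmorphM mulVf // rmorph1.
Qed.

(** [K * K] has zero divisors, so the divisor is monic, and the division is carried out so as to
    keep quotient and remainder over [G]. *)
Lemma poly_in_divp M q : M \is monic -> poly_in G M -> poly_in G q ->
  exists u r, [/\ poly_in G u, poly_in G r, q = u * M + r & (size r < size M)%N].
Proof.
move=> monM GM'; have [n] := ubnP (size q); elim: n q => // n IHn q lt_q Gq.
have [lt_qM|le_Mq] := ltnP (size q) (size M).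
  by exists 0, q; rewrite mul0r add0r; split=> // i; rewrite coef0; apply: graph0.
have M_gt0 : (0 < size M)%N by rewrite size_poly_gt0 monic_neq0.
pose m := (size q - size M)%N; pose c := lead_coef q.
have Gc : poly_in G (c%:P * 'X^m).
  by apply: poly_inM (poly_inXn _); apply: poly_inC; apply: Gq.
have [|u [r [Gu Gr def_q' ltr]]] := IHn (q - c%:P * 'X^m * M) _
    (poly_inB Gq (poly_inM Gc GM')).
  have q_gt0 := leq_trans M_gt0 le_Mq.
  apply: leq_trans (_ : size q <= n)%N => //; rewrite -[X in (_ < X)%N](prednK q_gt0).
  rewrite ltnS; apply/leq_sizeP => i le_i.
  have le_mi : (m <= i)%N by move: M_gt0 le_Mq le_i q_gt0; rewrite /m; clear; lia.
  rewrite coefB -mulrA coefCM coefXnM ltnNge le_mi /=.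
  have [->|neq_i] := eqVneq i (size q).-1.
    rewrite (_ : (_ - m)%N = (size M).-1); last by move: M_gt0 le_Mq; rewrite /m; clear; lia.
    by rewrite -[M`_ _]lead_coefE (monicP monM) mulr1 subrr.
  have le_qi : (size q <= i)%N by move: q_gt0 le_i neq_i; clear; lia.
  rewrite (nth_default 0 le_qi) [M`_ _]nth_default ?mulr0 ?subrr //.
  by apply: leq_trans (leq_sub2r _ le_qi); rewrite subKn.
exists (c%:P * 'X^m + u), r; split=> //; first exact: poly_inD.
by rewrite mulrDl -addrA -def_q' addrC subrK.
Qed.

(** One polynomial over pairs carries both the minimal polynomial of [a] over the domain of the
    embedding (through [fst]) and its image under the embedding (through [snd]). *)
Definition is_min_poly a (M : {poly P}) :=
  [/\ M \is monic, poly_in G M, root (map_poly fst M) a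
    & forall q, poly_in G q -> root (map_poly fst q) a -> (size q < size M)%N -> q = 0].

Lemma ex_min_poly (alg : separable_algebraic iota) a : exists M, is_min_poly a M.
Proof.
pose has n := `[< exists q, [/\ poly_in G q, q != 0, root (map_poly fst q) a
                             & size q = n] >].
have ex_has : exists n, has n.
  have [p [/separable_poly_neq0 p_neq0 pa]] := alg a.
  exists (size (map_poly diag p)); apply/asboolP; exists (map_poly diag p).
  split=> //; first exact: poly_in_diag.
    by rewrite map_poly_eq0_id0 // ?fmorph_eq0 ?lead_coef_eq0 // /diag
      -[0]/(0, 0) xpair_eqE fmorph_eq0 lead_coef_eq0 (negPf p_neq0).
  by rewrite -map_poly_comp.
case: (ex_minnP ex_has) => n /asboolP[q [Gq q_neq0 qa size_q]] min_n.
have [||y Gy yq] := @graph_inv alg (lead_coef q); rewrite ?lead_coef_eq0 //.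
  exact: Gq.
(* Scaling could lower the degree in a ring with zero divisors; here the top coefficient becomes
   1. *)
have size_yq : size (y *: q) = size q.
  apply/eqP; rewrite eqn_leq size_scale_leq /=.
  have: (y *: q)`_(size q).-1 != 0 by rewrite coefZ -lead_coefE yq oner_eq0.
  apply: contraR; rewrite -ltnNge => lt_yq.
  by rewrite nth_default // -ltnS prednK // lt0n size_poly_eq0.
exists (y *: q); split.
- by apply/monicP; rewrite lead_coefE size_yq coefZ -lead_coefE yq.
- by move=> i; rewrite coefZ; apply: GM.
- by rewrite map_polyZ /root hornerZ (eqP qa) mulr0.
- move=> r Gr ra; rewrite size_yq size_q => ltr; apply/eqP; apply: contraTT ltr => r_neq0.
  by rewrite -leqNgt; apply: min_n; apply/asboolP; exists r.
Qed.

Lemma min_poly_dvd a M q : is_min_poly a M -> poly_in G q ->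
  root (map_poly fst q) a -> exists2 u, poly_in G u & q = u * M.
Proof.
case=> monM GM' Ma minM Gq qa.
have [u [r [Gu Gr def_q ltr]]] := poly_in_divp monM GM' Gq.
exists u => //; rewrite def_q (minM r) ?addr0 //.
move: qa; rewrite def_q rmorphD rmorphM /= /root hornerD hornerM.
by rewrite (eqP Ma) mulr0 add0r.
Qed.

(** Sending [a] to [b] is well defined: a polynomial over [G] that kills [a] is a multiple of [M],
    and [M] vanishes at the pair [(a, b)] in both coordinates. *)
Lemma graph_adjoin a b M : is_min_poly a M -> root (map_poly snd M) b ->
  graph (adjoin G (a, b)).
Proof.
move=> minM Mb; split.
- by move=> c; apply: sub_adjoin.
- move=> _ _ [p Gp <-] [q Gq <-]; exists (p - q); rewrite ?hornerE //.
  exact: poly_inB.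
- move=> _ _ [p Gp <-] [q Gq <-]; exists (p * q); rewrite ?hornerM //.
  exact: poly_inM.
- move=> _ [q Gq <-] q0.
  have [|u Gu ->] := min_poly_dvd minM Gq.
    by rewrite /root -[a]/((a, b).1) horner_map /= q0.
  rewrite hornerM (_ : M.[_] = 0) ?mulr0 //.
  apply: injective_projections => /=.
    by rewrite -(horner_map fst) /=; apply/eqP; case: minM.
  by rewrite -(horner_map snd) /=; apply/eqP.
Qed.

Lemma min_poly_size a M : is_min_poly a M -> (1 < size M)%N.
Proof.
case=> monM _ Ma _; rewrite ltnNge; apply: contraTN Ma => size_M.
rewrite (_ : M = 1) ?rmorph1 ?root1 //.
by rewrite (size1_polyC size_M) (size1_monic size_M monM).
Qed.

(** The embedding fixes [k], so the transported polynomial still divides the separable polynomial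
    over [k] that kills [a]. This is what provides it with a root in [K], where only separable
    polynomials are known to have one. *)
Lemma min_poly_snd (alg : separable_algebraic iota) a M : is_min_poly a M ->
  separable_poly (map_poly snd M) /\ size (map_poly snd M) = size M.
Proof.
move=> minM; have [monM _ _ _] := minM; split; last first.
  by rewrite size_map_poly_id0 // (monicP monM) oner_eq0.
have [p [sep_p pa]] := alg a.
have [|u Gu def_p] := min_poly_dvd minM (poly_in_diag p); first by rewrite -map_poly_comp.
have : separable_poly (map_poly iota p) by rewrite separable_map.
rewrite (_ : map_poly iota p = map_poly snd (map_poly diag p)); last first.
  by rewrite -map_poly_comp.
by rewrite def_p rmorphM separable_mul => /and3P[].
Qed.

End Graph.

(** Zorn's lemma also asks for the union of the empty chain, and the empty set is not a graph; hence
    the predicate on [X] is that its union with [G0] is a graph. *)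
Lemma chain_graph (G0 : set P) (F : set (set P)) : graph G0 ->
  F `<=` [set X | graph (G0 `|` X)] -> total_on F subset ->
  graph (G0 `|` \bigcup_(X in F) X).
Proof.
move=> graph0' subF totF; set U := _ `|` _.
have [emptyF|] := pselect (F = set0).
  by rewrite /U emptyF bigcup_set0 setU0.
move=> /eqP/set0P[X0 FX0].
have one x : U x -> exists2 X, F X & (G0 `|` X) x.
  by case=> [G0x|[X FX Xx]]; [exists X0|exists X] => //; [left|right].
have subU X : F X -> G0 `|` X `<=` U.
  by move=> FX y [|Xy]; [left|right; exists X].
have two x y : U x -> U y -> exists X, [/\ F X, (G0 `|` X) x & (G0 `|` X) y].
  move=> /one[X FX Xx] /one[Y FY Yy]; have [XY|YX] := totF _ _ FX FY.
    by exists Y; split=> //; apply: setUS XY _ Xx.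
  by exists X; split=> //; apply: setUS YX _ Yy.
split.
- by move=> a; left; case: graph0'.
- move=> x y Ux Uy; have [X [FX Xx Xy]] := two _ _ Ux Uy.
  by apply: (subU _ FX); case: (subF _ FX) => _ h _ _; apply: h.
- move=> x y Ux Uy; have [X [FX Xx Xy]] := two _ _ Ux Uy.
  by apply: (subU _ FX); case: (subF _ FX) => _ _ h _; apply: h.
- move=> x /one[X FX Xx].
  by case: (subF _ FX) => _ _ _ h; apply: h.
Qed.

Hypothesis sepK : separable_closure iota.
Let alg : separable_algebraic iota. Proof. by case: sepK. Qed.
Let closedK : separably_closed K. Proof. by case: sepK. Qed.

Lemma graph_total (G0 : set P) : graph G0 ->
  exists G, [/\ graph G, G0 `<=` G & forall a, exists b, G (a, b)].
Proof.
move=> graphG0.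
have [A [graphA maxA]] := Zorn_bigcup (fun F => @chain_graph G0 F graphG0).
exists (G0 `|` A); split=> [//|x G0x|]; first by left.
move=> a; have [M minM] := ex_min_poly graphA alg a.
have [sepM sizeM] := min_poly_snd graphA alg minM.
have [|b Mb] := closedK sepM; first by rewrite sizeM (min_poly_size minM).
exists b; set G' := adjoin (G0 `|` A) (a, b).
have graphG' : graph G' by apply: graph_adjoin minM Mb.
have subG' : G0 `|` A `<=` G' by apply: sub_adjoin.
apply: contrapT => nGab; apply: (maxA G').
  split; first by move=> x Ax; apply: subG'; right.
  by move=> subA; apply: nGab; right; apply: subA; apply: mem_adjoin.
suff eqG' : G0 `|` G' = G' by change (graph (G0 `|` G')); rewrite eqG'.
by apply/seteqP; split=> [x [G0x|]//|x]; [apply: subG'; left|right].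
Qed.

(** A total graph is a field morphism, hence injective. It is onto because it maps the finite set of
    roots of a separable polynomial over [k] injectively into itself, and every element of [K] is
    such a root. *)
Lemma graph_absgal (G0 : set P) : graph G0 ->
  exists s : absgal iota, forall x, G0 x -> s x.1 = x.2.
Proof.
move=> /graph_total[G [graphG subG totG]].
have [Gd GB GM G_eq0] := graphG.
have Gfun a b b' : G (a, b) -> G (a, b') -> b = b'.
  move=> Gb Gb'; apply/eqP; rewrite -subr_eq0.
  by have /= := GB _ _ Gb Gb' => /G_eq0 /= /(_ (subrr a)) [_ ->].
pose f a := projT1 (cid (totG a)).
have Gf a : G (a, f a) by rewrite /f; case: cid.
have fB : zmod_morphism f.
  by move=> a b; apply: (Gfun _ _ _ (Gf _)); apply: (GB (a, _) (b, _)).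
have fM : GRing.monoid_morphism f.
  split; first by apply: Gfun (Gf 1) _; apply: graph1.
  by move=> a b; apply: (Gfun _ _ _ (Gf _)); apply: (GM (a, _) (b, _)).
have fk a : f (iota a) = iota a by apply: Gfun (Gf _) (Gd a).
pose fR : {rmorphism K -> K} := HB.pack f
  (GRing.isZmodMorphism.Build K K f fB) (GRing.isMonoidMorphism.Build K K f fM).
have f_inj : injective f := fmorph_inj fR.
have f_surj b : exists a, f a = b.
  have [p [sep_p pb]] := alg b.
  have [|rs uniq_rs rootE] := @separable_roots _ closedK (map_poly iota p).
    by rewrite separable_map.
  have fp : map_poly f (map_poly iota p) = map_poly iota p.
    by rewrite -(map_poly_comp fR); apply: eq_map_poly.
  have sub_f : {subset map f rs <= rs}.
    move=> _ /mapP[a ars ->]; rewrite -rootE -fp.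
    by rewrite (@mapf_root _ _ fR) rootE.
  have uniq_f : uniq (map f rs) by rewrite map_inj_uniq.
  have [_ eqrs] := uniq_min_size uniq_f sub_f (eq_leq (esym (size_map f rs))).
  by have := pb; rewrite rootE -eqrs => /mapP[a _ ->]; exists a.
have f_bij : bijective f.
  exists (fun b => projT1 (cid (f_surj b))) => [a|b]; last by case: cid.
  by apply: f_inj; case: cid.
exists (AbsGal (And4 fB fM f_bij fk)) => -[a b] /subG Gab /=.
exact: Gfun (Gf a) Gab.
Qed.

Lemma graph_base : graph (range diag).
Proof.
split.
- by move=> a; exists a.
- by move=> _ _ [a _ <-] [b _ <-]; exists (a - b); rewrite ?rmorphB.
- by move=> _ _ [a _ <-] [b _ <-]; exists (a * b); rewrite ?rmorphM.
- by move=> _ [a _ <-] /= /eqP; rewrite fmorph_eq0 => /eqP ->; rewrite rmorph0.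
Qed.

(** If [a] is not in [k], its minimal polynomial has degree at least 2 and, being separable, a
    second root [b]; the embedding that sends [a] to [b] extends to an automorphism moving [a]. *)
Lemma absgal_fixed a : (forall s : absgal iota, s a = a) -> exists b, iota b = a.
Proof.
move=> fixa; apply: contrapT => nka.
have [M minM] := ex_min_poly graph_base alg a.
have [monM GM Ma _] := minM.
have [sepM sizeM] := min_poly_snd graph_base alg minM.
have eqM : map_poly snd M = map_poly fst M.
  by apply/polyP => i; rewrite !coef_map /=; case: (GM i) => c _ <-.
have := Ma; rewrite -eqM => /factor_theorem[N defM].
have monN : map_poly snd M \is monic by apply: monic_map.
move: sepM; rewrite defM separable_mul => /and3P[sepN _].
rewrite coprimep_XsubC => nNa.
have sizeN : (1 < size N)%N.
  rewrite ltnNge; apply/negP => size_N; apply: nka.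
  have defN : N = 1.
    move: monN; rewrite defM monicMr ?monicXsubC // => monN.
    by rewrite (size1_polyC size_N) (size1_monic size_N monN).
  have [c _] := GM 0; have: (map_poly snd M)`_0 = - a.
    by rewrite defM defN mul1r coefB coefX coefC sub0r.
  rewrite coef_map /= => defa /(congr1 snd) /=; rewrite defa => defc.
  by exists (- c); rewrite rmorphN /= defc opprK.
have [b Nb] := closedK sepN sizeN.
have [|s sE] := @graph_absgal (adjoin (range diag) (a, b)).
  by apply: (graph_adjoin graph_base minM); rewrite defM rootM Nb.
have /= := sE _ (mem_adjoin graph_base (a, b)); rewrite fixa => eq_ab.
by rewrite eq_ab Nb in nNa.
Qed.

End FixedField.

(** * Hilbert 90 for a permutation module *)

Section Descent.
Variables (k K : fieldType) (iota : {rmorphism k -> K}).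
Hypothesis sepK : separable_closure iota.
Implicit Types s t : absgal iota.

Lemma absgal_fixed_mx m n (A : 'M[K]_(m, n)) :
  (forall s, map_mx s A = A) -> exists B, map_mx iota B = A.
Proof.
move=> fixA.
have ex i j : exists b, iota b = A i j.
  by apply: absgal_fixed => // s; rewrite -{2}(fixA s) mxE.
exists (\matrix_(i, j) projT1 (cid (ex i j))).
by apply/matrixP=> i j; rewrite !mxE; case: cid.
Qed.

Lemma absgalM s t a : (s * t)%g a = t (s a).
Proof. by []. Qed.

Lemma absgalVK s a : (s^-1)%g (s a) = a.
Proof. by rewrite -absgalM mulgV. Qed.

(** Independence of characters on a multiplicative set [B]: trace relations are available only on a
    subextension, so the automorphisms have to be told apart there. Subtracting [s0 y] times the
    relation at [x] from the relation at [x * y] removes the term of [s0]. *)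
Lemma dedekind_absgal (B : set K) (ss : seq (absgal iota)) (c : absgal iota -> K) :
  B 1 -> (forall x y, B x -> B y -> B (x * y)) -> uniq ss ->
  {in ss &, forall s t, s != t -> exists2 x, B x & s x != t x} ->
  (forall x, B x -> \sum_(s <- ss) c s * s x = 0) -> {in ss, forall s, c s = 0}.
Proof.
move=> B1 BM; elim: ss c => // s0 ss IHss c /= /andP[s0_ss uniq_ss] sepB sum0.
have c0 : {in ss, forall s, c s = 0}.
  move=> s s_ss.
  have [|||y By neq_y] := sepB s s0; rewrite ?inE ?s_ss ?eqxx ?orbT //.
    by apply: contraNneq s0_ss => <-.
  have := IHss (fun s => c s * (s y - s0 y)) uniq_ss _ _ s s_ss.
  move=> IH; apply/eqP.
  have /eqP : c s * (s y - s0 y) = 0.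
    apply: IH => [s1 s2 s1P s2P|x Bx].
      by apply: sepB; rewrite inE ?s1P ?s2P orbT.
    have := sum0 _ (BM _ _ Bx By); have := sum0 _ Bx.
    rewrite !big_cons => /eqP; rewrite addr_eq0 => /eqP defs.
    rewrite rmorphM mulrA defs mulNr addrC => /eqP.
    rewrite subr_eq0 => /eqP eq_sum.
    under eq_bigr do rewrite mulrBr mulrBl.
    rewrite sumrB; apply/eqP; rewrite subr_eq0; apply/eqP.
    transitivity (\sum_(s1 <- ss) c s1 * s1 (x * y)).
      by apply: eq_bigr => s1 _; rewrite rmorphM /= -!mulrA [s1 y * _]mulrC.
    rewrite eq_sum mulr_suml; apply: eq_bigr => s1 _.
    by rewrite -!mulrA [s0 y * _]mulrC.
  by rewrite mulf_eq0 subr_eq0 (negPf neq_y) orbF.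
move=> s; rewrite inE => /predU1P[->|/c0 //].
have := sum0 1 B1; rewrite big_cons rmorph1 mulr1 big_seq big1 ?addr0 //.
by move=> t /c0 ->; rewrite mul0r.
Qed.

Lemma absgal_stable_seq (e : seq K) :
  exists2 e' : seq K, {subset e <= e'} & forall s x, x \in e' -> s x \in e'.
Proof.
have [alg closedK] := sepK.
elim: e => [|a e [e' sub_e stab_e]]; first by exists [::].
have [p [sep_p pa]] := alg a.
have [|rs _ rootE] := @separable_roots _ closedK (map_poly iota p).
  by rewrite separable_map.
exists (rs ++ e') => [x|s x].
  rewrite inE mem_cat => /predU1P[->|/sub_e ->]; last by rewrite orbT.
  by rewrite -rootE pa.
rewrite !mem_cat => /orP[|/stab_e->]; last by rewrite orbT.
rewrite -!rootE => px; apply/orP; left.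
have -> : map_poly iota p = map_poly s (map_poly iota p).
  by rewrite -map_poly_comp; apply: eq_map_poly => b /=; rewrite absgal_iota.
by rewrite mapf_root.
Qed.

(* The Galois group acts on a finite stable set through a finite quotient.    *)
Lemma absgal_transversal (e : seq K) :
  (forall s x, x \in e -> s x \in e) ->
  exists ss : seq (absgal iota), uniq ss /\
    (forall t, exists2 s, s \in ss & {in e, s =1 t}) /\
    {in ss &, forall s t, {in e, s =1 t} -> s = t}.
Proof.
wlog uniq_e : e / uniq e => [IH stab_e|stab_e].
  have [|s x|ss [uniq_ss [covers sepss]]] := IH (undup e); first exact: undup_uniq.
    by rewrite !mem_undup; apply: stab_e.
  exists ss; split=> //; split=> [t|s t s_ss t_ss eq_st].
    by have [s s_ss eq_st] := covers t; exists s => // x; rewrite -mem_undup => /eq_st.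
  by apply: sepss => // x; rewrite mem_undup => /eq_st.
pose n := size e.
pose rel (f : {ffun 'I_n -> 'I_n}) s := forall i : 'I_n, s e`_i = e`_(f i).
have acts s : exists f, rel f s.
  have ex (i : 'I_n) : exists j : 'I_n, s e`_i = e`_j.
    have := stab_e s _ (mem_nth 0 (ltn_ord i)).
    by move=> /(nthP 0)[j lt_j <-]; exists (Ordinal lt_j).
  by exists [ffun i => projT1 (cid (ex i))] => i; rewrite ffunE; case: cid.
have rel_inj f g s : rel f s -> rel g s -> f = g.
  move=> fs gs; apply/ffunP => i; apply/val_inj/eqP.
  by have /eqP := etrans (esym (fs i)) (gs i); rewrite nth_uniq.
have rel_eq f s t : rel f s -> rel f t -> {in e, s =1 t}.
  move=> fs ft x /(nthP 0)[i lt_i <-].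
  by rewrite (fs (Ordinal lt_i)) (ft (Ordinal lt_i)).
have eq_rel f s t : rel f s -> {in e, s =1 t} -> rel f t.
  by move=> fs eq_st i; rewrite -eq_st ?fs //; apply: mem_nth.
(* The default is harmless: [rep] is used only at those [f] that some automorphism induces. *)
pose rep f : absgal iota :=
  if pselect (exists s, rel f s) is left h then projT1 (cid h) else 1%g.
have repP f s : rel f s -> rel f (rep f).
  by move=> fs; rewrite /rep; case: pselect => [h|[]]; [case: cid|exists s].
pose fs := [seq f <- enum {ffun 'I_n -> 'I_n} | `[< exists s, rel f s >]].
have fsP f : reflect (exists s, rel f s) (f \in fs).
  by rewrite mem_filter mem_enum andbT; apply: asboolP.
exists (map rep fs); split; [|split].
- rewrite map_inj_in_uniq => [|f g]; first exact/filter_uniq/enum_uniq.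
  move=> /fsP[s fs_s] /fsP[t gs_t] eq_fg; apply: rel_inj (repP _ _ fs_s) _.
  by rewrite eq_fg; apply: repP gs_t.
- move=> t; have [f ft] := acts t; exists (rep f).
    by apply: map_f; apply/fsP; exists t.
  exact: rel_eq (repP _ _ ft) ft.
- move=> _ _ /mapP[f /fsP[s fs_s] ->] /mapP[g /fsP[t gs_t] ->] eq_fg.
  by congr rep; apply: rel_inj (repP _ _ gs_t); apply: eq_rel eq_fg; apply: repP fs_s.
Qed.

Section PermutationModule.
Variable rho : absgal iota -> 'S_3.
Hypothesis rho_hom : absgal_hom iota rho.

Let rhoM s t : rho (s * t)%g = (rho s * rho t)%g.
Proof. by case: rho_hom => h _; apply: h. Qed.

Lemma absgal_hom1 : rho 1%g = 1%g.
Proof. by apply: (mulgI (rho 1%g)); rewrite -rhoM !mulg1. Qed.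

(** Continuity at 1 is enough: if [s] and [t] agree on [e], then [s * t^-1] fixes [e]. Stability of
    [e] is what later gives a finite set of representatives. *)
Lemma absgal_hom_finite : exists e : seq K,
  (forall s x, x \in e -> s x \in e) /\ forall s t, {in e, s =1 t} -> rho s = rho t.
Proof.
have [_ /(_ 1%g)[e0 e0P]] := rho_hom.
have [e sub_e stab_e] := absgal_stable_seq e0.
exists e; split=> // s t eq_st.
have /e0P : {in e0, (s * t^-1)%g =1 1%g :> absgal iota}.
  by move=> x /sub_e xe; rewrite absgalM eq_st // absgalVK.
rewrite rhoM absgal_hom1 => rho1; apply: (mulIg (rho t^-1%g)).
by rewrite rho1 -rhoM mulgV absgal_hom1.
Qed.

(** Entrywise, [s (a i) = a (rho s i)]: such columns are the elements of the cubic etale algebra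
    attached to [rho], written through its three embeddings into [K]. *)
Definition equivariant_col (a : 'cV[K]_3) :=
  forall s, map_mx s a = row_perm (rho s) a.

(* Otherwise the traces to the permutation module of the elements of a finite *)
(* Galois subextension would contradict the independence of characters.       *)
Lemma equivariant_col_nondegenerate (c : 'rV[K]_3) : c != 0 ->
  exists2 a, equivariant_col a & c *m a != 0.
Proof.
move=> c_neq0; apply: contrapT => nex.
have c_eq0 a : equivariant_col a -> c *m a = 0.
  by move=> eqa; apply/eqP; apply: contrapT => /negP ca; apply: nex; exists a.
have [e [stab_e rho_e]] := absgal_hom_finite.
have [ss [uniq_ss [covers sep_ss]]] := absgal_transversal stab_e.
(* The subextension on which an automorphism is determined by its action on [e]; [ss] is its Galois
   group. *)
pose B : set K := [set x | forall s t, {in e, s =1 t} -> s x = t x].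
have Be x : x \in e -> B x by move=> xe s t; apply.
pose rep t := projT1 (cid2 (covers t)).
have rep_ss t : rep t \in ss by rewrite /rep; case: cid2.
have rep_e t : {in e, rep t =1 t} by rewrite /rep; case: cid2.
(* The trace of [x] placed at [i0]: each conjugate [s x] is added to the entry to which [rho s]
   moves [i0]. Composition with [t] permutes [ss] up to automorphisms that agree on [B], whence
   equivariance. *)
pose tr i0 x : 'cV[K]_3 := \col_i \sum_(s <- ss | rho s i0 == i) s x.
have tr_eq i0 x : B x -> equivariant_col (tr i0 x).
  move=> Bx t; apply/matrixP => i j; rewrite !mxE rmorph_sum /=.
  have perm_ss : perm_eq [seq rep (s * t)%g | s <- ss] ss.
    have uniq_rep : uniq [seq rep (s * t)%g | s <- ss].
      rewrite map_inj_in_uniq // => s1 s2 s1P s2P eq_rep; apply: sep_ss => // y ye.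
      have := rep_e (s1 * t)%g y ye; rewrite eq_rep rep_e // !absgalM => eq_t.
      by rewrite -(absgalVK t (s1 y)) -eq_t absgalVK.
    have sub_rep : {subset [seq rep (s * t)%g | s <- ss] <= ss}.
      by move=> _ /mapP[s _ ->].
    apply: uniq_perm => //.
    by case: (uniq_min_size uniq_rep sub_rep); rewrite ?size_map.
  rewrite -[RHS](perm_big _ perm_ss) big_map /=; apply: eq_big => s.
    rewrite (rho_e _ (s * t)%g (rep_e _)) rhoM permM.
    by rewrite (inj_eq perm_inj).
  by move=> _; rewrite -absgalM; apply: Bx => y ye; rewrite rep_e.
have c0 i : c 0 i = 0.
  pose s0 := rep 1%g.
  have rho_s0 : rho s0 = 1%g by rewrite (rho_e s0 1%g (rep_e _)) absgal_hom1.
  (* Pairing [c] with the trace placed at [i] gives a relation among the characters in which [s] has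
     coefficient [c 0 (rho s i)]; the representative [s0] of the identity exhibits [c 0 i]. *)
  have -> : i = rho s0 i by rewrite rho_s0 perm1.
  apply: (@dedekind_absgal B ss (fun s => c 0 (rho s i))) => //.
  - by move=> s t _; rewrite !rmorph1.
  - by move=> x y Bx By s t eq_st; rewrite !rmorphM /= (Bx s t) // (By s t).
  - move=> s t s_ss t_ss; apply: contraNP => nB; apply/eqP/sep_ss => // x xe.
    apply/eqP; apply: contrapT => /negP neq_st; apply: nB; exists x => //.
    exact: Be.
  - move=> x Bx; have /matrixP/(_ 0 0) := c_eq0 _ (tr_eq i x Bx).
    rewrite !mxE => tr0; rewrite -[RHS]tr0.
    rewrite (partition_big (fun s => rho s i) xpredT) //=; apply: eq_bigr => j _.
    by rewrite !mxE mulr_sumr; apply: eq_bigr => s /eqP ->.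
  - exact: rep_ss.
by case/eqP: c_neq0; apply/rowP => i; rewrite c0 mxE.
Qed.

(** Columns are added one at a time: as long as there are fewer than three, some nonzero row [c]
    kills them all, and nondegeneracy yields an equivariant column that [c] does not kill. *)
Lemma equivariant_frame :
  exists2 L : 'M[K]_3, L \in unitmx & forall s, map_mx s L = row_perm (rho s) L.
Proof.
suff frames r : (r <= 3)%N -> exists2 L : 'M[K]_(3, r),
    forall s, map_mx s L = row_perm (rho s) L & row_free L^T.
  have [//|L eqL freeL] := frames 3%N.
  by exists L => //; rewrite -unitmx_tr -row_free_unit.
elim: r => [|r IHr] le_r.
  by exists 0 => [s|]; [apply/matrixP => i []|apply: inj_row_free => v _; apply/rowP => -[]].
have [L eqL freeL] := IHr (ltnW le_r).
have [c c_neq0 cL] : exists2 c : 'rV[K]_3, c != 0 & c *m L = 0.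
  have /rowV0Pn[c cK c_neq0] : kermx L != 0.
    rewrite -mxrank_eq0 mxrank_ker subn_eq0 -ltnNge.
    by rewrite -mxrank_tr (eqP freeL).
  by exists c => //; apply/sub_kermxP.
have [a eqa ca] := equivariant_col_nondegenerate c_neq0.
suff free_aL : row_free (row_mx a L)^T.
  exists (row_mx a L) => // s.
  have -> : map_mx s (row_mx a L) = row_mx (map_mx s a) (map_mx s L) by apply: map_row_mx.
  by rewrite eqL eqa; apply/matrixP => i j; rewrite !mxE; case: fintype.split => j'; rewrite !mxE.
apply: inj_row_free => v; rewrite tr_row_mx -[v]hsubmxK mul_row_col => vL.
have v0 : lsubmx v = 0.
  have := congr1 (fun M => c *m M^T) vL.
  rewrite linearD /= !trmx_mul !trmxK mulmxDr !mulmxA cL mul0mx addr0 trmx0 mulmx0.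
  rewrite [c *m a]mx11_scalar mul_scalar_mx => /eqP.
  rewrite scaler_eq0 => /orP[ca0|/eqP lv0]; last by rewrite -[lsubmx v]trmxK lv0 trmx0.
  by case/eqP: ca; rewrite [c *m a]mx11_scalar (eqP ca0) raddf0.
move: vL; rewrite v0 mul0mx add0r => vL.
have -> : rsubmx v = 0 by apply: (row_free_inj freeL); rewrite vL mul0mx.
exact: row_mx0.
Qed.

End PermutationModule.
End Descent.

(** * Points of the projective line *)

Section Wedge.
Variable K : fieldType.
Implicit Types v w : 'rV[K]_2.

Definition wedge v w := v 0 0 * w 0 1 - v 0 1 * w 0 0.

Lemma ord2P (P : 'I_2 -> Prop) : P 0 -> P 1 -> forall i, P i.
Proof.
move=> P0 P1; case=> [[|[|//]]] lt_i; first by have -> : Ordinal lt_i = 0 by apply: val_inj.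
by have -> : Ordinal lt_i = 1 by apply: val_inj.
Qed.

Lemma rv2P v w : v 0 0 = w 0 0 -> v 0 1 = w 0 1 -> v = w.
Proof. by move=> e0 e1; apply/rowP; apply: ord2P. Qed.

Definition rv2 (a b : K) : 'rV[K]_2 := \row_j (if j == 0 then a else b).

Lemma rv2E a b : (rv2 a b 0 0 = a) * (rv2 a b 0 1 = b).
Proof. by rewrite !mxE. Qed.

Lemma rv2_neq0 v : (v != 0) = (v 0 0 != 0) || (v 0 1 != 0).
Proof.
apply/idP/idP; last by move=> h; apply: contraTneq h => ->; rewrite !mxE eqxx.
by apply: contraNT; rewrite negb_or !negbK => /andP[/eqP e0 /eqP e1];
  apply/eqP/rv2P; rewrite mxE.
Qed.

Lemma wedgevv v : wedge v v = 0.
Proof. by rewrite /wedge mulrC subrr. Qed.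

Lemma wedgeC v w : wedge v w = - wedge w v.
Proof. by rewrite /wedge; ring. Qed.

Lemma wedgeZl a v w : wedge (a *: v) w = a * wedge v w.
Proof. by rewrite /wedge !mxE; ring. Qed.

Lemma wedge_neq0l v w : wedge v w != 0 -> v != 0.
Proof. by apply: contraNneq => ->; rewrite /wedge !mxE !mul0r subrr. Qed.

Lemma wedge_eq0P v w : v != 0 -> w != 0 -> wedge v w = 0 ->
  exists2 a, a != 0 & w = a *: v.
Proof.
move=> v_neq0 w_neq0 /eqP; rewrite /wedge subr_eq0 => /eqP vw.
suff [a def_w] : exists a, w = a *: v.
  exists a => //; apply: contraNneq w_neq0 => a0.
  by rewrite def_w a0 scale0r.
move: v_neq0; rewrite rv2_neq0; have [v0 /= v1|v0 _] := eqVneq (v 0 0) 0.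
  exists (w 0 1 / v 0 1); apply: rv2P; rewrite !mxE ?divfK // v0 mulr0.
  by move/eqP: vw; rewrite v0 mul0r eq_sym mulf_eq0 (negPf v1) => /eqP.
exists (w 0 0 / v 0 0); apply: rv2P; rewrite !mxE ?divfK //.
by apply: (mulfI v0); rewrite vw; field.
Qed.

Lemma wedge0_trans u v w : v != 0 -> u != 0 -> w != 0 ->
  wedge u v = 0 -> wedge v w = 0 -> wedge u w = 0.
Proof.
move=> v0 u0 w0 uv /(wedge_eq0P v0 w0)[a _ ->].
by rewrite wedgeC wedgeZl wedgeC uv oppr0 mulr0 oppr0.
Qed.

Lemma P1_eqE (v w : P1rep K) :
  (\pi_(P1 K)%qT v == \pi_(P1 K)%qT w) = (wedge (val v) (val w) == 0).
Proof.
rewrite piE /P1eq; apply/idP/eqP => [/andP[/sub_rVP[a ->] _]|].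
  by rewrite wedgeZl wedgevv mulr0.
move=> /(wedge_eq0P (valP v) (valP w))[a a0 def_w].
by change (P1eq v w); rewrite /P1eq def_w; apply/eqmxP/eqmx_sym; apply: eqmx_scale.
Qed.

Lemma wedge_repr_pi (v : P1rep K) (p : P1 K) : p = \pi_(P1 K)%qT v ->
  wedge (val (generic_quotient.repr p)) (val v) = 0.
Proof. by move=> def_p; apply/eqP; rewrite -P1_eqE generic_quotient.reprK def_p. Qed.

(** The first nonzero coordinate becomes 1. The result depends only on the line and commutes with
    field morphisms, so Galois acts on these vectors as on the points, with no scalar cocycle. *)
Definition normal v := (if v 0 0 == 0 then (v 0 1)^-1 else (v 0 0)^-1) *: v.

Lemma normalP v : v != 0 -> exists2 a, a != 0 & normal v = a *: v.
Proof.
rewrite rv2_neq0 /normal; case: eqP => [_ /= v1|/eqP v0 _].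
  by exists (v 0 1)^-1; rewrite ?invr_eq0.
by exists (v 0 0)^-1; rewrite ?invr_eq0.
Qed.

Lemma normal_neq0 v : v != 0 -> normal v != 0.
Proof.
by move=> v0; have [a a0 ->] := normalP v0; rewrite scaler_eq0 negb_or a0.
Qed.

Lemma wedge_normal v : v != 0 -> wedge v (normal v) = 0.
Proof.
by move=> v0; have [a a0 ->] := normalP v0; rewrite wedgeC wedgeZl wedgevv mulr0 oppr0.
Qed.

Lemma normal_eq v w : v != 0 -> w != 0 -> wedge v w = 0 -> normal v = normal w.
Proof.
move=> v0 w0 /(wedge_eq0P v0 w0)[a a0 ->]; rewrite /normal !mxE mulf_eq0.
rewrite (negPf a0) /= scalerA; case: ifP => _; congr (_ *: _);
by rewrite invfM mulrAC mulVf // mul1r.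
Qed.

End Wedge.

Lemma map_normal (K K' : fieldType) (f : {rmorphism K -> K'}) (v : 'rV[K]_2) :
  map_mx f (normal v) = normal (map_mx f v).
Proof.
by rewrite /normal map_mxZ !mxE fmorph_eq0; congr (_ *: _); case: ifP; rewrite fmorphV.
Qed.

Lemma map_wedge (K K' : fieldType) (f : {rmorphism K -> K'}) (v w : 'rV[K]_2) :
  wedge (map_mx f v) (map_mx f w) = f (wedge v w).
Proof. by rewrite /wedge !mxE rmorphB !rmorphM. Qed.

Section FourthPoint.
Variable K : fieldType.
Hypothesis closedK : separably_closed K.

Lemma separably_closed_neq01 : exists2 t : K, t != 0 & t != 1.
Proof.
have [three0|three_neq0] := eqVneq (3%:R : K) 0.
  exists (-1); rewrite ?oppr_eq0 ?oner_eq0 // -subr_eq0 -opprD oppr_eq0.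
  apply: contraTneq (oner_neq0 K) => two0.
  have one : 1 = 3%:R - (1 + 1) :> K by ring.
  by rewrite negbK one three0 two0 subrr.
pose p : {poly K} := 'X^2 + 'X + 1.
(* The identity is 4p - (2X + 1)p' = 3, with 3 invertible in this branch; the discriminant of X^2 +
   X + 1 is -3. *)
have sep_p : separable_poly p.
  rewrite unlock; apply/Bezout_coprimepP; exists (4%:R, - ('X *+ 2 + 1)) => /=.
  rewrite (_ : _ + _ = 3%:R%:P) ?polyC_eqp1 //.
  by rewrite /p !derivE; ring.
have size_p : size p = 3%N.
  by rewrite /p -addrA size_polyDl ?size_polyXn // -[1]/(1%:P) size_XaddC.
have [|t] := closedK sep_p; first by rewrite size_p.
rewrite /root /p !hornerE => /eqP pt; exists t.
  by apply: contra_eq_neq pt => ->; rewrite expr0n /= !add0r oner_neq0.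
apply: contra_eq_neq pt => ->; rewrite expr1n.
by rewrite (_ : 1 + 1 + 1 = 3%:R) //; ring.
Qed.

Lemma wedge_ne0_row (p q : 'rV[K]_2) : wedge p q != 0 ->
  forall x y, exists v, wedge v p = x /\ wedge v q = y.
Proof.
move=> pq x y; exists ((wedge p q)^-1 *: (y *: p - x *: q)).
by rewrite !wedgeZl /wedge !mxE; split; field.
Qed.

(** Up to sign and scaling, the wedges with [p0] and [p1] are coordinates; the points (1, 1) and (1,
    t) avoid both. As t is not 1 they are distinct, so at most one of them is the third point. *)
Lemma fourth_point (p : 'I_3 -> 'rV[K]_2) :
  (forall i j, i != j -> wedge (p i) (p j) != 0) ->
  exists v, forall i, wedge v (p i) != 0.
Proof.
move=> p_ne; have [t t0 t1] := separably_closed_neq01.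
pose p0 := p 0; pose p1 := p 1; pose p2 := p 2%:R.
have p01 : wedge p0 p1 != 0 by apply: p_ne.
have p02 : wedge p0 p2 != 0 by apply: p_ne.
have p12 : wedge p1 p2 != 0 by apply: p_ne.
have [v [v0 v1]] := wedge_ne0_row p01 1 1.
have [w [w0 w1]] := wedge_ne0_row p01 1 t.
have all3 u : wedge u p0 != 0 -> wedge u p1 != 0 -> wedge u p2 != 0 ->
    forall i, wedge u (p i) != 0.
  move=> u0 u1 u2 i.
  have: i \in [:: 0; 1; 2%:R] by case: i => [[|[|[|]]]].
  by rewrite !inE => /or3P[] /eqP ->.
have [v2|v2] := eqVneq (wedge v p2) 0; last first.
  by exists v; apply: all3; rewrite ?v0 ?v1 ?oner_eq0.
exists w; apply: all3; rewrite ?w0 ?w1 ?oner_eq0 //.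
have rel u : wedge p0 p1 * wedge u p2 = wedge p0 p2 * wedge u p1 - wedge p1 p2 * wedge u p0.
  by rewrite /wedge; ring.
apply/eqP => w2.
have := rel w; have := rel v; rewrite v2 w2 v0 v1 w0 w1 mulr0 !mulr1.
move=> eq1 eq2; move/eqP: t1; apply.
have : wedge p0 p2 * (t - 1) = 0 
  by rewrite -[RHS](subrr (0 : K)) {1}eq2 eq1; ring.
by move=> /eqP; rewrite mulf_eq0 (negPf p02) subr_eq0 => /eqP.
Qed.

End FourthPoint.

(** * Binary cubic forms *)

Lemma ord3E (i : 'I_3) : [|| i == 0, i == 1 | i == 2%:R].
Proof. by case: i => [[|[|[|]]]]. Qed.

Section Vieta.
Variable K : fieldType.

Lemma vieta2 (b c d r0 r1 : K) : r0 != r1 ->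
  b * r0 ^+ 2 + c * r0 + d = 0 -> b * r1 ^+ 2 + c * r1 + d = 0 ->
  c = - b * (r0 + r1) /\ d = b * (r0 * r1).
Proof.
rewrite -subr_eq0 => r01 e0 e1.
have ec : c = - b * (r0 + r1).
  apply: (mulfI r01); apply/eqP; rewrite -subr_eq0 -[0](subrr (0 : K)).
  by rewrite -{1}e0 -{1}e1; apply/eqP; ring.
split=> //; apply/eqP; rewrite -subr_eq0; apply/eqP.
by rewrite -[RHS]e0 ec; ring.
Qed.

Lemma vieta3 (a b c d r0 r1 r2 : K) : r0 != r1 -> r0 != r2 -> r1 != r2 ->
  a * r0 ^+ 3 + b * r0 ^+ 2 + c * r0 + d = 0 ->
  a * r1 ^+ 3 + b * r1 ^+ 2 + c * r1 + d = 0 ->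
  a * r2 ^+ 3 + b * r2 ^+ 2 + c * r2 + d = 0 ->
  [/\ b = - a * (r0 + r1 + r2), c = a * (r0 * r1 + r0 * r2 + r1 * r2)
    & d = - a * (r0 * r1 * r2)].
Proof.
move=> r01 r02 r12 e0 e1 e2.
have quot r : r0 != r -> a * r ^+ 3 + b * r ^+ 2 + c * r + d = 0 ->
    a * r ^+ 2 + (b + a * r0) * r + (c + b * r0 + a * r0 ^+ 2) = 0.
  rewrite -subr_eq0 => r0r er; apply: (mulfI r0r); rewrite mulr0.
  by rewrite -[RHS](subrr (0 : K)) -{1}e0 -{1}er; ring.
have [eb ec] := vieta2 r12 (quot _ r01 e1) (quot _ r02 e2).
have eb' : b = - a * (r0 + r1 + r2).
  by apply: (addIr (a * r0)); rewrite eb; ring.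
have ec' : c = a * (r0 * r1 + r0 * r2 + r1 * r2).
  apply: (addIr (b * r0 + a * r0 ^+ 2)); rewrite addrA ec eb'; ring.
split=> //; apply/eqP; rewrite -subr_eq0; apply/eqP.
by rewrite -[RHS]e0 eb' ec'; ring.
Qed.

Hypothesis closedK : separably_closed K.

Lemma separable_quadratic_roots (b c d : K) : b != 0 -> c ^+ 2 - 4%:R * b * d != 0 ->
  exists r0 r1, [/\ r0 != r1, c = - b * (r0 + r1) & d = b * (r0 * r1)].
Proof.
move=> b0 D0; pose q : {poly K} := b%:P * 'X^2 + c%:P * 'X + d%:P.
have sep_q : separable_poly q.
  rewrite unlock; apply/Bezout_coprimepP.
  (* The identity is q'^2 - 4bq = c^2 - 4bd, valid in characteristic 2 as well. *)
  exists (- (4%:R * b%:P), (2%:R * b%:P) * 'X + c%:P) => /=.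
  rewrite (_ : _ + _ = (c ^+ 2 - 4%:R * b * d)%:P) ?polyC_eqp1 //.
  by rewrite /q !derivE; ring.
have size_q : size q = 3%N.
  rewrite (_ : q = Poly [:: d; c; b]); first by rewrite (@PolyK _ 0).
  by rewrite /q /= !cons_poly_def; ring.
have [rs uniq_rs def_q] := separable_split closedK sep_q.
have size_rs : size rs = 2%N.
  have := size_q; rewrite def_q size_scale ?lead_coef_eq0 ?separable_poly_neq0 //.
  by rewrite size_prod_XsubC => -[].
have rootq r : r \in rs -> b * r ^+ 2 + c * r + d = 0.
  move=> r_rs; have : root q r.
    by rewrite def_q rootZ ?lead_coef_eq0 ?separable_poly_neq0 // root_prod_XsubC.
  by rewrite /root /q !hornerE => /eqP.
case: rs size_rs uniq_rs rootq {def_q} => [|r0 [|r1 [|//]]] //= _.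
rewrite inE andbT => r01 rootq; exists r0, r1.
have [||ec ed] := @vieta2 b c d r0 r1 r01; rewrite ?rootq ?inE ?eqxx ?orbT //.
Qed.

(* The Bezout coefficients come from solving the linear system that expresses *)
(* the discriminant as a combination of the polynomial and its derivative.    *)
Lemma separable_cubic_roots (a b c d : K) : a != 0 ->
  b ^+ 2 * c ^+ 2 - 4%:R * a * c ^+ 3 - 4%:R * b ^+ 3 * d
    - 27%:R * a ^+ 2 * d ^+ 2 + 18%:R * a * b * c * d != 0 ->
  exists r0 r1 r2, [/\ r0 != r1, r0 != r2 & r1 != r2] /\
    [/\ b = - a * (r0 + r1 + r2), c = a * (r0 * r1 + r0 * r2 + r1 * r2)
      & d = - a * (r0 * r1 * r2)].
Proof.
move=> a0 D0; pose q : {poly K} := a%:P * 'X^3 + b%:P * 'X^2 + c%:P * 'X + d%:P.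
have sep_q : separable_poly q.
  rewrite unlock; apply/Bezout_coprimepP.
  pose w : K := 2%:R * b ^+ 2 - 6%:R * a * c.
  pose v1 : K := 9%:R * a ^+ 2 * d + 2%:R * b ^+ 3 - 7%:R * a * b * c.
  pose v0 : K := b ^+ 2 * c - 4%:R * a * c ^+ 2 + 3%:R * a * b * d.
  exists ((- (3%:R * a * w))%:P * 'X + (b * w - 3%:R * v1)%:P,
          (a * w)%:P * 'X^2 + v1%:P * 'X + v0%:P) => /=.
  rewrite (_ : _ + _ = (b ^+ 2 * c ^+ 2 - 4%:R * a * c ^+ 3 - 4%:R * b ^+ 3 * d
    - 27%:R * a ^+ 2 * d ^+ 2 + 18%:R * a * b * c * d)%:P) ?polyC_eqp1 //.
  by rewrite /q /w /v1 /v0 !derivE; ring.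
have size_q : size q = 4%N.
  rewrite (_ : q = Poly [:: d; c; b; a]); first by rewrite (@PolyK _ 0).
  by rewrite /q /= !cons_poly_def; ring.
have [rs uniq_rs def_q] := separable_split closedK sep_q.
have size_rs : size rs = 3%N.
  have := size_q; rewrite def_q size_scale ?lead_coef_eq0 ?separable_poly_neq0 //.
  by rewrite size_prod_XsubC => -[].
have rootq r : r \in rs -> a * r ^+ 3 + b * r ^+ 2 + c * r + d = 0.
  move=> r_rs; have : root q r.
    by rewrite def_q rootZ ?lead_coef_eq0 ?separable_poly_neq0 // root_prod_XsubC.
  by rewrite /root /q !hornerE => /eqP.
case: rs size_rs uniq_rs rootq {def_q} => [|r0 [|r1 [|r2 [|//]]]] //= _.
rewrite !inE andbT negb_or => /andP[/andP[r01 r02] r12] rootq; exists r0, r1, r2.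
split=> //; apply: vieta3 => //; by rewrite rootq // !inE eqxx ?orbT.
Qed.

End Vieta.

Section CubicForm.
Variables (k K : fieldType) (iota : {rmorphism k -> K}).
Hypothesis sepK : separable_closure iota.
Implicit Types (s t : absgal iota) (v : 'rV[K]_2).
Let closedK : separably_closed K. Proof. by case: sepK. Qed.

Lemma mdeg2 (m : 'X_{1.. 2}) : mdeg m = (m 0%R + m 1%R)%N.
Proof.
rewrite mdegE big_ord_recl big_ord1; congr (_ + m _)%N; exact: val_inj.
Qed.

Lemma cubic_monomE n j : ((U_(0%R) *+ n + U_(1%R) *+ j)%MM : 'X_{1.. 2}) 0%R = n
  /\ ((U_(0%R) *+ n + U_(1%R) *+ j)%MM : 'X_{1.. 2}) 1%R = j.
Proof.
by rewrite !mnmDE !mulmnE !mnm1E /= !mul1n !mul0n addn0.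
Qed.

Lemma cubicE (R : comNzRingType) (F : {mpoly R[2]}) : F \is 3.-homog for mdeg ->
  F = \sum_(j < 4) cubic_coef F j *: 'X_[(U_(0%R) *+ (3 - j) + U_(1%R) *+ j)%MM].
Proof.
move=> homF; apply/mpolyP => m; rewrite raddf_sum /=.
have [deg_m|deg_m] := eqVneq (mdeg m) 3%N; last first.
  rewrite (dhomog_nemf_coeff homF deg_m) big1 // => j _.
  rewrite mcoeffZ mcoeffX; case: eqP => [def_m|]; last by rewrite mulr0.
  case/eqP: deg_m; rewrite -def_m mdegD !mdegMn !mdeg1 !mul1n.
  by rewrite subnK // -ltnS.
have lt_m : (m 1%R < 4)%N by rewrite ltnS -deg_m mdeg2 leq_addl.
have def_m : (U_(0%R) *+ (3 - m 1%R) + U_(1%R) *+ m 1%R)%MM = m.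
  by apply/mnmP; have [e0 e1] := cubic_monomE (3 - m 1%R) (m 1%R); apply: ord2P;
    rewrite ?e0 ?e1 // -deg_m mdeg2 addnK.
rewrite (bigD1 (Ordinal lt_m)) //= mcoeffZ mcoeffX def_m eqxx mulr1 big1 ?addr0.
  by rewrite /cubic_coef def_m.
move=> j neq_j; rewrite mcoeffZ mcoeffX; case: eqP => [eq_m|]; last by rewrite mulr0.
by case/eqP: neq_j; apply: val_inj => /=; rewrite -eq_m (cubic_monomE _ _).2.
Qed.

Definition zero_form (F : {mpoly k[2]}) v : Prop :=
  (map_mpoly iota F).@[fun i => v ord0 i] = 0.

Lemma homog_map_mpoly n d (F : {mpoly k[n]}) : F \is d.-homog for mdeg ->
  map_mpoly iota F \is d.-homog for mdeg.
Proof.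
move=> /dhomogP homF; apply/dhomogP => m.
rewrite mcoeff_msupp mcoeff_map_mpoly => Fm; apply: homF.
by rewrite mcoeff_msupp; apply: contraNneq Fm => ->; rewrite raddf0.
Qed.

Lemma eval_cubic (F : {mpoly k[2]}) (v : 'I_2 -> K) : F \is 3.-homog for mdeg ->
  (map_mpoly iota F).@[v] =
    iota (cubic_coef F 0) * v 0 ^+ 3 + iota (cubic_coef F 1) * v 0 ^+ 2 * v 1
  + iota (cubic_coef F 2) * v 0 * v 1 ^+ 2 + iota (cubic_coef F 3) * v 1 ^+ 3.
Proof.
move=> /homog_map_mpoly homF; rewrite (cubicE homF) !big_ord_recr big_ord0 /= add0r.
have monE n j : 'X_[(U_(0%R) *+ n + U_(1%R) *+ j)%MM].@[v] = v 0 ^+ n * v 1 ^+ j.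
  rewrite mevalX big_ord_recl big_ord1 /=; have [-> e1] := cubic_monomE n j.
  have -> : lift ord0 ord0 = 1 :> 'I_2 by apply: val_inj.
  by rewrite e1.
rewrite !mevalD !mevalZ !monE /cubic_coef !mcoeff_map_mpoly.
by rewrite !subSS !subn0 /=; ring.
Qed.

Definition marked (F : {mpoly k[2]}) (p : 'I_3 -> 'rV[K]_2) : Prop :=
  (forall i j, i != j -> wedge (p i) (p j) != 0) /\
  forall v, v != 0 -> (zero_form F v <-> exists i, wedge v (p i) = 0).

Lemma marked_neq0 F p : marked F p -> forall i, p i != 0.
Proof.
move=> [p_ne _] i; apply: (@wedge_neq0l _ _ (p (i + 1))); apply: p_ne.
by case: i => [[|[|[|]]]].
Qed.

Lemma marked_zero F p : marked F p -> forall i, zero_form F (p i).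
Proof.
move=> mFp i; have [_ h] := mFp; apply/h; first exact: marked_neq0 mFp i.
by exists i; rewrite wedgevv.
Qed.

Section OneForm.
Variable F : {mpoly k[2]}.
Hypothesis homF : F \is 3.-homog for mdeg.
Let a := iota (cubic_coef F 0).
Let b := iota (cubic_coef F 1).
Let c := iota (cubic_coef F 2).
Let d := iota (cubic_coef F 3).

Let zeroE v : zero_form F v <-> a * v 0 0 ^+ 3 + b * v 0 0 ^+ 2 * v 0 1
  + c * v 0 0 * v 0 1 ^+ 2 + d * v 0 1 ^+ 3 = 0.
Proof. by rewrite /zero_form eval_cubic. Qed.

Let discE : iota (disc F) = b ^+ 2 * c ^+ 2 - 4%:R * a * c ^+ 3 - 4%:R * b ^+ 3 * d
    - 27%:R * a ^+ 2 * d ^+ 2 + 18%:R * a * b * c * d.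
Proof. by rewrite /disc /a /b /c /d; ring. Qed.

Lemma marked_factor e p0 p1 p2 : e != 0 ->
  wedge p0 p1 != 0 -> wedge p0 p2 != 0 -> wedge p1 p2 != 0 ->
  (forall v, a * v 0 0 ^+ 3 + b * v 0 0 ^+ 2 * v 0 1
    + c * v 0 0 * v 0 1 ^+ 2 + d * v 0 1 ^+ 3
    = e * (wedge v p0 * wedge v p1 * wedge v p2)) ->
  exists p, marked F p.
Proof.
move=> e0 p01 p02 p12 FE; exists (tnth [tuple p0; p1; p2]); split.
  move=> i j; have /or3P[] := ord3E i; have /or3P[] := ord3E j => /eqP-> /eqP-> //= _;
  rewrite !(tnth_nth 0) //= wedgeC oppr_eq0 //.
move=> v v0; rewrite zeroE FE; split=> [/eqP|[i]].
  rewrite !mulf_eq0 (negPf e0) /= -orbA => /or3P[] /eqP vp.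
  - by exists 0; rewrite (tnth_nth 0).
  - by exists 1; rewrite (tnth_nth 0).
  - by exists 2%:R; rewrite (tnth_nth 0).
have /or3P[] := ord3E i => /eqP->; rewrite (tnth_nth 0) /= => ->;
by rewrite ?mulr0 ?mul0r ?mulr0.
Qed.

Lemma disc_marked : disc F != 0 -> exists p, marked F p.
Proof.
(* If [a = 0], the point (1 : 0) is a zero, and the discriminant is b^2 times that of the quadratic
   cofactor. *)
rewrite -(fmorph_eq0 iota) discE; have [a0|a0] := eqVneq a 0.
  rewrite a0 !mulr0 !mul0r !expr0n /= !mulr0 !mul0r !subr0 !addr0.
  rewrite (_ : _ - _ = b ^+ 2 * (c ^+ 2 - 4%:R * b * d)); last by ring.
  rewrite mulf_eq0 expf_eq0 /= negb_or => /andP[b0 D0].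
  have [r0 [r1 [r01 ec ed]]] := separable_quadratic_roots closedK b0 D0.
  apply: (@marked_factor (- b) (rv2 1 0) (rv2 r0 1) (rv2 r1 1)).
  - by rewrite oppr_eq0.
  - by rewrite /wedge !rv2E mul1r mul0r subr0 oner_neq0.
  - by rewrite /wedge !rv2E mul1r mul0r subr0 oner_neq0.
  - by rewrite /wedge !rv2E mulr1 mul1r subr_eq0.
  - by move=> v; rewrite /wedge !rv2E a0 ec ed; ring.
move=> D0; have [r0 [r1 [r2 [[r01 r02 r12] [eb ec ed]]]]] := separable_cubic_roots closedK a0 D0.
apply: (@marked_factor a (rv2 r0 1) (rv2 r1 1) (rv2 r2 1)) => //.
- by rewrite /wedge !rv2E mulr1 mul1r subr_eq0.
- by rewrite /wedge !rv2E mulr1 mul1r subr_eq0.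
- by rewrite /wedge !rv2E mulr1 mul1r subr_eq0.
- by move=> v; rewrite /wedge !rv2E eb ec ed; ring.
Qed.

Lemma marked_disc p : marked F p -> disc F != 0.
Proof.
move=> mFp; have [p_ne zeros] := mFp; have p_zero := marked_zero mFp.
have w10 i : wedge (rv2 1 0) (p i) = p i 0 1.
  by rewrite /wedge !rv2E; ring.
have n10 : rv2 1 0 != 0 :> 'rV[K]_2 by rewrite rv2_neq0 rv2E oner_neq0.
pose r i := p i 0 0 / p i 0 1.
have r_ne i j : i != j -> p i 0 1 != 0 -> p j 0 1 != 0 -> r i != r j.
  move=> ij i1 j1; apply: contraNneq (p_ne _ _ ij) => eq_r; rewrite /wedge.
  have -> : p i 0 0 = r i * p i 0 1 by rewrite /r divfK.
  have -> : p j 0 0 = r j * p j 0 1 by rewrite /r divfK.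
  by rewrite eq_r; apply/eqP; ring.
have root_r i : p i 0 1 != 0 -> a * r i ^+ 3 + b * r i ^+ 2 + c * r i + d = 0.
  move=> i1; have /zeroE := p_zero i.
  have -> : p i 0 0 = r i * p i 0 1 by rewrite /r divfK.
  move=> e; apply: (mulIf (expf_neq0 3 i1)); rewrite mul0r -[RHS]e; ring.
rewrite -(fmorph_eq0 iota) discE; have [a0|a0] := eqVneq a 0.
  have /zeros-/(_ n10)[i] : zero_form F (rv2 1 0).
    by apply/zeroE; rewrite !rv2E a0; ring.
  rewrite w10 => i1.
  have nz j : i != j -> p j 0 1 != 0.
    move=> ij; apply: contraNneq (p_ne _ _ ij) => j1.
    by rewrite /wedge i1 j1 mulr0 mul0r subrr.
  have ij : i != i + 1 by case: i {i1 nz} => [[|[|[|]]]].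
  have il : i != i + 2%:R by case: i {i1 nz ij} => [[|[|[|]]]].
  have jl : i + 1 != i + 2%:R by case: i {i1 nz ij il} => [[|[|[|]]]].
  have r12 := r_ne _ _ jl (nz _ ij) (nz _ il).
  have root2 j : p j 0 1 != 0 -> b * r j ^+ 2 + c * r j + d = 0.
    by move=> /root_r; rewrite a0 mul0r add0r.
  have [ec ed] := vieta2 r12 (root2 _ (nz _ ij)) (root2 _ (nz _ il)).
  (* If [b = 0], Vieta gives [c = d = 0] and the form vanishes identically, also at a point outside
     the three marked zeros. *)
  have b0 : b != 0.
    apply/eqP => b0; have [v v_ne] := fourth_point closedK p_ne.
    have v0 : v != 0 := wedge_neq0l (v_ne 0).
    have /zeros-/(_ v0)[j /eqP] : zero_form F v.
      by apply/zeroE; rewrite a0 ec ed b0; ring.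
    by rewrite (negPf (v_ne j)).
  rewrite a0 ec ed (_ : _ + _ = b ^+ 4 * (r (i + 1) - r (i + 2%:R)) ^+ 2); last by ring.
  by rewrite mulf_neq0 ?expf_neq0 // subr_eq0.
have nz i : p i 0 1 != 0.
  rewrite -w10; apply/eqP => w0; case/eqP: a0.
  have /zeroE : zero_form F (rv2 1 0) by apply/zeros => //; exists i.
  by rewrite !rv2E => <-; ring.
have r01 : r 0 != r 1 by apply: r_ne.
have r02 : r 0 != r 2%:R by apply: r_ne.
have r12 : r 1 != r 2%:R by apply: r_ne.
have [eb ec ed] := vieta3 r01 r02 r12 (root_r _ (nz _)) (root_r _ (nz _)) (root_r _ (nz _)).
rewrite eb ec ed (_ : _ + _ = a ^+ 4 * ((r 0 - r 1) ^+ 2 * (r 0 - r 2%:R) ^+ 2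
   * (r 1 - r 2%:R) ^+ 2)); last by ring.
by rewrite !mulf_neq0 ?expf_neq0 // subr_eq0.
Qed.

End OneForm.
End CubicForm.

(** * Labellings of the zeros and the class of homomorphisms *)

Section Gamma.
Variables (k K : fieldType) (iota : {rmorphism k -> K}).
Implicit Types (s t : absgal iota) (v : 'rV[K]_2) (p : 'I_3 -> 'rV[K]_2).
Implicit Type rho : absgal iota -> 'S_3.

Definition equivariant rho m n (A : 'I_3 -> 'M[K]_(m, n)) : Prop :=
  forall s i, map_mx s (A i) = A (rho s i).

Lemma normalK v : v != 0 -> normal (normal v) = normal v.
Proof.
by move=> v0; apply/esym/normal_eq; rewrite ?normal_neq0 ?wedge_normal.
Qed.

Variable F : {mpoly k[2]}.
Hypothesis homF : F \is 3.-homog for mdeg.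

Lemma zero_form_wedge v w : v != 0 -> w != 0 -> wedge v w = 0 ->
  zero_form iota F v -> zero_form iota F w.
Proof.
move=> v0 w0 /(wedge_eq0P v0 w0)[a _ ->]; rewrite /zero_form !eval_cubic //.
rewrite !mxE => F0; rewrite -[RHS](mulr0 (a ^+ 3)) -[in RHS]F0; ring.
Qed.

Lemma zero_form_absgal s v : zero_form iota F v -> zero_form iota F (map_mx s v).
Proof.
rewrite /zero_form !eval_cubic // !mxE => F0.
have fixF j : s (iota (cubic_coef F j)) = iota (cubic_coef F j) by apply: absgal_iota.
rewrite -(fixF 0) -(fixF 1) -(fixF 2) -(fixF 3) -[RHS](rmorph0 s) -[in RHS]F0.
by ring.
Qed.

Lemma marked_normal p : marked iota F p -> marked iota F (fun i => normal (p i)).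
Proof.
move=> mFp; have [p_ne zeros] := mFp; have p0 := marked_neq0 mFp; split.
  move=> i j ij; have [x x0 ->] := normalP (p0 i); have [y y0 ->] := normalP (p0 j).
  by rewrite wedgeZl wedgeC wedgeZl mulf_neq0 // oppr_eq0 mulf_neq0 // p_ne // eq_sym.
move=> v v0; rewrite zeros //; split=> -[i vp]; exists i.
  by apply: wedge0_trans vp _; rewrite ?normal_neq0 ?wedge_normal.
apply: wedge0_trans vp _; rewrite ?normal_neq0 //.
by rewrite wedgeC wedge_normal ?oppr0.
Qed.

Lemma marked_inj p : marked iota F p -> injective p.
Proof.
move=> [p_ne _] i j eq_p; apply/eqP; apply: contraT => /p_ne.
by rewrite eq_p wedgevv eqxx.
Qed.

(** Passage from points to vectors: with normalised representatives, equality of points is equality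
    of vectors, so the action on labelled zeros becomes [equivariant]. *)
Lemma gammaP rho : gamma iota F rho <->
  exists2 p, marked iota F p & equivariant rho p.
Proof.
split=> [[z [z_zero z_inj z_surj] z_eq]|[p mFp p_eq]].
  pose q i := val (generic_quotient.repr (z i)).
  have q0 i : q i != 0 := valP (generic_quotient.repr (z i)).
  exists (fun i => normal (q i)); last first.
    move=> s i; rewrite map_normal; apply: normal_eq => //; first by rewrite map_mx_eq0.
    by have := wedge_repr_pi (esym (z_eq s i)); rewrite wedgeC => /eqP; rewrite oppr_eq0 => /eqP.
  apply: (@marked_normal q); split.
    move=> i j ij; apply: contraNneq ij => qij; apply/eqP/z_inj; rewrite ?inE //.
    rewrite -[z i]generic_quotient.reprK -[z j]generic_quotient.reprK.
    by apply/eqP; rewrite P1_eqE; apply/eqP.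
  move=> v v0; split=> [v_zero|[i]]; last first.
    by move=> vq; apply: (@zero_form_wedge (q i)) (z_zero i I); rewrite // wedgeC vq oppr0.
  pose r : P1rep K := Sub v v0.
  have wr := wedge_repr_pi (erefl (\pi_(P1 K)%qT r)).
  have : P1_zeros iota F (\pi_(P1 K)%qT r).
    apply: zero_form_wedge v_zero => //.
      exact: valP (generic_quotient.repr (\pi_(P1 K)%qT r)).
    by rewrite wedgeC wr oppr0.
  by move=> /z_surj[i _ /wedge_repr_pi zi]; exists i; rewrite wedgeC zi oppr0.
have p0 := marked_neq0 mFp; have [p_ne zeros] := mFp.
pose r i : P1rep K := Sub (p i) (p0 i).
have rP i := wedge_repr_pi (erefl (\pi_(P1 K)%qT (r i))).
exists (fun i => \pi_(P1 K)%qT (r i)); last first.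
  move=> s i; rewrite /absgal_P1; apply/eqP; rewrite P1_eqE /=.
  by rewrite -p_eq map_wedge (rP i) rmorph0.
split.
- move=> i _; apply: zero_form_wedge (marked_zero mFp i) => //.
    exact: valP (generic_quotient.repr (\pi_(P1 K)%qT (r i))).
  by rewrite wedgeC rP oppr0.
- move=> i j _ _ /eqP; rewrite P1_eqE => /eqP pij; apply/eqP; apply: contraT => /p_ne.
  by rewrite [wedge _ _]pij eqxx.
- move=> q /zeros-/(_ (valP (generic_quotient.repr q)))[i qi]; exists i => //; apply/esym/eqP.
  by rewrite -[q]generic_quotient.reprK P1_eqE; apply/eqP.
Qed.

Lemma marked_gamma p : marked iota F p ->
  exists2 rho, absgal_hom iota rho & gamma iota F = hom_class rho.
Proof.
move=> /[dup] /marked_neq0 p0' /marked_normal.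
set q := fun i => normal (p i) => mFq; have [q_ne zeros] := mFq.
have q0 := marked_neq0 mFq; have q_inj := marked_inj mFq.
have q_zero := marked_zero mFq.
have qP v : v != 0 -> zero_form iota F v -> exists i, normal v = q i.
  move=> v0 /zeros-/(_ v0)[i vq]; exists i.
  by rewrite (normal_eq _ _ vq) // /q normalK.
have normal_q i : normal (q i) = q i by rewrite /q normalK.
have ex s i : exists j, map_mx s (q i) = q j.
  have [|j eq_j] := qP (map_mx s (q i)) _ (zero_form_absgal s (q_zero i)).
    by rewrite map_mx_eq0.
  by exists j; rewrite -eq_j -map_normal normal_q.
pose f s i := projT1 (cid (ex s i)).
have fE s i : map_mx s (q i) = q (f s i) by rewrite /f; case: cid.
have f_inj s : injective (f s).
  by move=> i j eq_f; apply: q_inj; apply: (@map_mx_inj _ _ s); rewrite !fE eq_f.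
pose rho s : 'S_3 := perm (@f_inj s).
have rhoE : equivariant rho q by move=> s i; rewrite fE permE.
exists rho.
  split=> [s t|s].
    apply/permP => i; apply: q_inj; rewrite permM -!rhoE -map_mx_comp.
    by apply: eq_map_mx.
  (* An automorphism permutes the zeros according to its values on the six coordinates of the
     normalised vectors, which gives continuity. *)
  exists [seq q x.1 0 x.2 | x <- enum (('I_3 * 'I_2)%type : finType)] => t eq_ts.
  apply/permP => i; apply: q_inj; rewrite -!rhoE; apply/matrixP => i0 j.
  rewrite [LHS]mxE [RHS]mxE ord1; apply: eq_ts; apply/mapP; exists (i, j) => //.
  by rewrite mem_enum.
apply/funext => rho'; apply/propext; split=> [/gammaP[p' /[dup] mFp' /marked_normal mFq' p'_eq]|].
  have p'0 := marked_neq0 mFp'; have [q'_ne _] := mFq'.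
  have ex_u i : exists j, normal (p' i) = q j.
    exact: qP (p'0 i) (marked_zero mFp' i).
  pose g i := projT1 (cid (ex_u i)).
  have gE i : normal (p' i) = q (g i) by rewrite /g; case: cid.
  have g_inj : injective g.
    by move=> i j eq_g; apply: (marked_inj mFq') => /=; rewrite !gE eq_g.
  pose u : 'S_3 := perm g_inj; exists (u^-1)%g => //.
  apply/funext => s; apply/permP => i.
  rewrite conjgE invgK !permM; apply: (@perm_inj _ u); rewrite permKV.
  apply: q_inj; rewrite -rhoE !permE -!gE map_normal p'_eq //.
move=> [u _ <-]; apply/gammaP; exists (fun i => q ((u^-1)%g i)).
  split=> [i j ij|v v0]; first by apply: q_ne; rewrite (inj_eq perm_inj).
  rewrite zeros //; split=> -[i vq]; first by exists (u i); rewrite permK.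
  by exists ((u^-1)%g i).
by move=> s i; rewrite rhoE conjgE !permM permK.
Qed.

End Gamma.

Lemma hom_class_eq (k K : fieldType) (iota : {rmorphism k -> K})
    (rho rho' : absgal iota -> 'S_3) :
  hom_class rho rho' -> hom_class rho' = hom_class rho.
Proof.
move=> [u _ <-]; apply/seteqP; split=> _ [w _ <-].
  by exists (u * w)%g => //; apply/funext => s; rewrite conjgM.
by exists (u^-1 * w)%g => //; apply/funext => s; rewrite -conjgM mulKVg.
Qed.

(** * Equivariant frames *)

Section Stack.
Variable d : nat.

(** Inverse of [mxvec_index], so that [vec_mx] cuts a row of length [3 * d] into the three blocks of
    [stack]. *)
Definition split_index (a : 'I_(3 * d)) : 'I_3 * 'I_d :=
  enum_val (cast_ord (esym (mxvec_cast 3 d)) a).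

Lemma split_indexK i c : split_index (mxvec_index i c) = (i, c).
Proof. by rewrite /split_index /mxvec_index cast_ordK enum_rankK. Qed.

Lemma mxvec_indexK a : mxvec_index (split_index a).1 (split_index a).2 = a.
Proof. by case/mxvec_indexP: a => i c; rewrite split_indexK. Qed.

Definition stack (R : Type) n (L : 'I_3 -> 'M[R]_(d, n)) : 'M[R]_(3 * d, n) :=
  \matrix_(a, b) L (split_index a).1 (split_index a).2 b.

Lemma stackE (R : Type) n (L : 'I_3 -> 'M[R]_(d, n)) i c b :
  stack L (mxvec_index i c) b = L i c b.
Proof. by rewrite mxE split_indexK. Qed.

Lemma map_stack (R S : Type) (f : R -> S) n (L : 'I_3 -> 'M[R]_(d, n)) :
  map_mx f (stack L) = stack (fun i => map_mx f (L i)).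
Proof. by apply/matrixP => a b; rewrite !mxE. Qed.

Lemma eq_stack (R : Type) n (L L' : 'I_3 -> 'M[R]_(d, n)) :
  L =1 L' -> stack L = stack L'.
Proof. by move=> eqL; apply/matrixP => a b; rewrite !mxE eqL. Qed.

Definition index_perm_fun (u : 'S_3) (a : 'I_(3 * d)) : 'I_(3 * d) :=
  mxvec_index (u (split_index a).1) (split_index a).2.

Fact index_perm_inj u : injective (index_perm_fun u).
Proof.
move=> a b /(congr1 split_index); rewrite !split_indexK => -[/perm_inj e1 e2].
by rewrite -[a]mxvec_indexK e1 e2 mxvec_indexK.
Qed.

Definition index_perm u := perm (@index_perm_inj u).

Lemma stack_perm (R : Type) n (L : 'I_3 -> 'M[R]_(d, n)) (u : 'S_3) :
  stack (fun i => L (u i)) = row_perm (index_perm u) (stack L).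
Proof. by apply/matrixP => a b; rewrite !mxE permE split_indexK. Qed.

Section Ring.
Variable R : comNzRingType.

Lemma stack_mul n n' (L : 'I_3 -> 'M[R]_(d, n)) (A : 'M[R]_(n, n')) :
  stack L *m A = stack (fun i => L i *m A).
Proof. by apply/matrixP => a b; rewrite !mxE; apply: eq_bigr => j _; rewrite mxE. Qed.

Lemma stack_gram n (L L' : 'I_3 -> 'M[R]_(d, n)) (A : 'M[R]_n) i c j e :
  (stack L *m A *m (stack L')^T) (mxvec_index i c) (mxvec_index j e)
  = (L i *m A *m (L' j)^T) c e.
Proof.
rewrite stack_mul !mxE; apply: eq_bigr => b _.
by rewrite [_^T _ _]mxE !stackE [_^T _ _]mxE.
Qed.

Lemma mul_stack n (L : 'I_3 -> 'M[R]_(d, n)) (t : 'rV[R]_(3 * d)) :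
  t *m stack L = \sum_i row i (vec_mx t) *m L i.
Proof.
apply/rowP => b; rewrite mxE summxE.
under [RHS]eq_bigr do rewrite mxE.
rewrite pair_bigA /= (reindex (fun ic => mxvec_index ic.1 ic.2)) /=; last first.
  exists split_index => [[i c] _|a _] /=; first exact: split_indexK.
  exact: mxvec_indexK.
by apply: eq_bigr => -[i c] _; rewrite stackE !mxE.
Qed.

End Ring.

Section Field.
Variable K : fieldType.

Lemma stack_eq (L M L' M' : 'I_3 -> 'M[K]_(d, 3 * d)) (A B : 'M[K]_(3 * d)) :
  (forall i j, L i *m A *m (L' j)^T = M i *m B *m (M' j)^T) ->
  stack L *m A *m (stack L')^T = stack M *m B *m (stack M')^T.
Proof.
move=> eqLM; apply/matrixP => a b; rewrite -[a]mxvec_indexK -[b]mxvec_indexK.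
by rewrite !stack_gram eqLM.
Qed.

Lemma stack_unit_eq (L L' : 'I_3 -> 'M[K]_(d, 3 * d)) (A B : 'M[K]_(3 * d)) :
  stack L \in unitmx -> stack L' \in unitmx ->
  (forall i j, L i *m A *m (L' j)^T = L i *m B *m (L' j)^T) -> A = B.
Proof.
move=> uL uL' /stack_eq eqAB; rewrite -unitmx_tr in uL'.
by apply: (can_inj (mulKmx uL)); apply: (can_inj (mulmxK uL')).
Qed.

End Field.
End Stack.

Lemma det2 (R : comNzRingType) (A : 'M[R]_2) :
  \det A = A 0 0 * A 1 1 - A 0 1 * A 1 0.
Proof.
rewrite (expand_det_row _ 0) !big_ord_recl big_ord0 /cofactor !det_mx11 !mxE /=.
have -> : lift 0 0 = 1 :> 'I_2 by apply: val_inj.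
have -> : lift 1 0 = 0 :> 'I_2 by apply: val_inj.
rewrite /= !expr0 ?expr1; ring.
Qed.

Lemma wedge_mul (K : fieldType) (v w : 'rV[K]_2) (A : 'M[K]_2) :
  wedge (v *m A) (w *m A) = wedge v w * \det A.
Proof.
rewrite det2 /wedge !mxE !big_ord_recl !big_ord0 /=.
have -> : lift ord0 ord0 = 1 :> 'I_2 by apply: val_inj.
by ring.
Qed.

Section Frames.
Variables (k K : fieldType) (iota : {rmorphism k -> K}).
Hypothesis sepK : separable_closure iota.
Implicit Types (s t : absgal iota).
Variable rho : absgal iota -> 'S_3.
Variable d : nat.
Local Notation n := (3 * d)%N.

Definition comp (R : Type) m (x : 'M[R]_m * 'M[R]_m) (j : 'I_2) : 'M[R]_m :=
  if j == 0 then x.1 else x.2.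

(** Two frames are kept because in case (a) rows and columns move under independent groups. At a
    zero of the linear form [Q i], the rows of [L i] lie in the left kernel of that member of the
    pencil and those of [L' i] in the right kernel. *)
Definition framed (J : 'M[K]_d) (x : 'M[k]_n * 'M[k]_n)
    (L L' : 'I_3 -> 'M[K]_(d, n)) (Q : 'I_3 -> 'rV[K]_2) : Prop :=
  [/\ [/\ equivariant rho L, equivariant rho L' & equivariant rho Q],
      [/\ stack L \in unitmx & stack L' \in unitmx],
      forall i j, i != j -> wedge (Q i) (Q j) != 0
    & forall i l j, L i *m map_mx iota (comp x j) *m (L' l)^T
                    = ((i == l)%:R * Q i 0 j) *: J].

(** A Galois element permutes the blocks of both stacks in the same way, so the permutation matrix
    cancels in the quotient, which therefore comes from [k]. *)
Lemma stack_descent (L M : 'I_3 -> 'M[K]_(d, n)) :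
  equivariant rho L -> equivariant rho M -> stack L \in unitmx ->
  exists g : 'M[k]_n, map_mx iota g = invmx (stack L) *m stack M.
Proof.
move=> eqL eqM uL; apply: absgal_fixed_mx => // s.
rewrite map_mxM map_invmx !map_stack.
rewrite (eq_stack (eqL s)) (eq_stack (eqM s)) !stack_perm !row_permE.
set P := perm_mx _; have uP : P \in unitmx by apply: unitmx_perm.
have uPL : P *m stack L \in unitmx by rewrite unitmx_mul uP.
apply: (can_inj (mulKmx uPL)).
by rewrite mulKVmx // -mulmxA mulKVmx.
Qed.

Lemma absgal_map_iota m1 m2 s (A : 'M[k]_(m1, m2)) :
  map_mx s (map_mx iota A) = map_mx iota A.
Proof. by apply/matrixP => i j; rewrite !mxE absgal_iota. Qed.

Lemma framed_act J x L L' Q (g1 g2 : 'M[k]_n) (h : 'M[k]_2) :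
  g1 \in unitmx -> g2 \in unitmx -> h \in unitmx -> framed J x L L' Q ->
  framed J (act_pair h (g1 *m x.1 *m g2^T, g1 *m x.2 *m g2^T))
    (fun i => L i *m map_mx iota (invmx g1)) (fun i => L' i *m map_mx iota (invmx g2))
    (fun i => Q i *m map_mx iota h^T).
Proof.
move=> ug1 ug2 uh [[eqL eqL' eqQ] [uL uL'] Q_ne gram]; split.
- by split=> s i; rewrite map_mxM absgal_map_iota ?eqL ?eqL' ?eqQ.
- by split; rewrite -stack_mul unitmx_mul ?uL ?uL' map_unitmx unitmx_inv.
- move=> i j ij; rewrite wedge_mul mulf_neq0 ?Q_ne //.
  by rewrite det_map_mx fmorph_eq0 det_tr -unitfE -unitmxE.
move=> i l j; rewrite trmx_mul.
have -> : comp (act_pair h (g1 *m x.1 *m g2^T, g1 *m x.2 *m g2^T)) j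
    = g1 *m (h j 0 *: comp x 0 + h j 1 *: comp x 1) *m g2^T.
  by move: j; apply: ord2P; rewrite /comp /act_pair /= mulmxDr mulmxDl -!scalemxAr -!scalemxAl.
rewrite !map_mxM -!map_trmx !mulmxA.
rewrite -[L i *m _ *m _]mulmxA -map_mxM mulVmx // map_mx1 mulmx1.
rewrite -[_ *m _ *m (map_mx iota (invmx g2))^T]mulmxA.
rewrite -trmx_mul -map_mxM mulVmx // map_mx1 trmx1 mulmx1.
rewrite map_mxD !map_mxZ mulmxDr mulmxDl -!scalemxAr -!scalemxAl !gram.
rewrite !scalerA -scalerDl; congr (_ *: _).
rewrite !mxE !big_ord_recl big_ord0 /= !mxE.
have -> : lift ord0 ord0 = 1 :> 'I_2 by apply: val_inj.
by ring.
Qed.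

Section Equivalence.
(** These matrices absorb the scalar [e] by which two linear forms can differ once their zeros have
    been matched. The pair is (e, 1) in case (a); in case (b) both must be equal, since one group
    element acts on both sides. *)
Variables (J : 'M[K]_d) (D D' : K -> 'M[K]_d).
Hypothesis D_J : forall e, D e *m J *m (D' e)^T = e *: J.
Hypothesis D_unit : forall e, e != 0 -> D e \in unitmx /\ D' e \in unitmx.
Hypothesis D_map : forall s e, map_mx s (D e) = D (s e) /\ map_mx s (D' e) = D' (s e).

Lemma stack_scale_unit (E : 'I_3 -> 'M[K]_d) (L : 'I_3 -> 'M[K]_(d, n)) :
  (forall i, E i \in unitmx) -> stack L \in unitmx ->
  stack (fun i => E i *m L i) \in unitmx.
Proof.
move=> uE uL; rewrite -row_free_unit; apply: inj_row_free => t.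
rewrite mul_stack => t0.
pose t' := mxvec (\matrix_i (row i (vec_mx t) *m E i)).
have : t' *m stack L = 0.
  by rewrite mul_stack -[RHS]t0; apply: eq_bigr => i _; rewrite mxvecK rowK mulmxA.
move=> /(congr1 (mulmx^~ (invmx (stack L)))); rewrite mulmxK // mul0mx => t'0.
rewrite -[t]vec_mxK; apply/eqP; rewrite mxvec_eq0; apply/eqP/row_matrixP => i.
have := congr1 (fun M => row i (vec_mx M)) t'0; rewrite mxvecK rowK !linear0.
by move=> /(congr1 (mulmx^~ (invmx (E i)))); rewrite mulmxK // mul0mx.
Qed.

(** Cramer's coefficients, with indices modulo 3, of the linear relation among three vectors in the
    plane. *)
Definition cowedge (Q : 'I_3 -> 'rV[K]_2) (i : 'I_3) := wedge (Q (i + 1)) (Q (i + 2%:R)).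

Lemma cowedge_rel (Q : 'I_3 -> 'rV[K]_2) j :
  cowedge Q 0 * Q 0 0 j + cowedge Q 1 * Q 1 0 j + cowedge Q 2%:R * Q 2%:R 0 j = 0.
Proof.
rewrite /cowedge !add0r.
have -> : 1 + 1 = 2%:R :> 'I_3 by apply: val_inj.
have -> : 1 + 2%:R = 0 :> 'I_3 by apply: val_inj.
have -> : 2%:R + 1 = 0 :> 'I_3 by apply: val_inj.
have -> : 2%:R + 2%:R = 1 :> 'I_3 by apply: val_inj.
by move: j; apply: ord2P; rewrite /wedge; ring.
Qed.

(* A Galois element acts on the coefficients of the linear relation between   *)
(* three vectors up to a sign, which cancels in the ratio.                    *)
Lemma cowedge_ratio_equivariant Q Q' : equivariant rho Q -> equivariant rho Q' ->
  forall s i, s (cowedge Q i / cowedge Q' i)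
              = cowedge Q (rho s i) / cowedge Q' (rho s i).
Proof.
move=> eqQ eqQ' s i; rewrite fmorph_div /cowedge -!map_wedge !eqQ !eqQ'.
have ne (a b : 'I_3) : a != b -> rho s a != rho s b by rewrite (inj_eq perm_inj).
have i1 : i != i + 1 by case: i => [[|[|[|]]]].
have i2 : i != i + 2%:R by case: i {i1} => [[|[|[|]]]].
have i12 : i + 1 != i + 2%:R by case: i {i1 i2} => [[|[|[|]]]].
move: (ne _ _ i1) (ne _ _ i2) (ne _ _ i12).
move: (rho s i) (rho s (i + 1)) (rho s (i + 2%:R)) => a b c ab ac bc.
have [[-> ->]|[-> ->]] : (b = a + 1 /\ c = a + 2%:R) \/ (b = a + 2%:R /\ c = a + 1).
- move: ab ac bc; case: a => [[|[|[|]]]] // ?; case: b => [[|[|[|]]]] // ?;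
  by case: c => [[|[|[|]]]] // ? _ _ _; (left + right); split; apply: val_inj.
- by [].
by rewrite wedgeC [in X in _ / X]wedgeC invrN mulrNN.
Qed.

(** With these factors, the vectors [P i = e i *: Q i] satisfy the same linear relation as the
    [Q' i]; so the matrix that sends the first two to their targets sends the third one as well. It
    is determined by these values, which Galois permutes compatibly, hence it is defined over
    [k]. *)
Lemma triple_transfer (Q Q' : 'I_3 -> 'rV[K]_2) :
  equivariant rho Q -> equivariant rho Q' ->
  (forall i j, i != j -> wedge (Q i) (Q j) != 0) ->
  (forall i j, i != j -> wedge (Q' i) (Q' j) != 0) ->
  exists2 h : 'M[k]_2, h \in unitmx
  & forall i, Q' i = (cowedge Q i / cowedge Q' i) *: (Q i *m map_mx iota h^T).
Proof.
move=> eqQ eqQ' Q_ne Q'_ne.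
pose e i := cowedge Q i / cowedge Q' i.
have cow_ne (Q0 : 'I_3 -> 'rV[K]_2) i : (forall i j, i != j -> wedge (Q0 i) (Q0 j) != 0) ->
    cowedge Q0 i != 0.
  by move=> ne; apply: ne; case: i => [[|[|[|]]]].
have e_ne i : e i != 0 by rewrite mulf_neq0 ?invr_eq0 ?cow_ne.
pose mk (v w : 'rV[K]_2) : 'M[K]_2 := \matrix_(i < 2) (if i == 0 then v else w).
have mkE v w : \det (mk v w) = wedge v w by rewrite det2 !mxE.
pose P i := e i *: Q i.
pose A := mk (P 0) (P 1); pose A' := mk (Q' 0) (Q' 1).
have uA : A \in unitmx.
  rewrite unitmxE mkE wedgeZl wedgeC wedgeZl unitfE mulf_neq0 // oppr_eq0.
  by rewrite mulf_neq0 ?Q_ne.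
have uA' : A' \in unitmx by rewrite unitmxE mkE unitfE Q'_ne.
pose M := invmx A *m A'.
have rowA v w B : (mk v w *m B = mk (v *m B) (w *m B)).
  by apply/row_matrixP => i; rewrite row_mul !rowK; case: ifP.
have mk_inj v w v' w' : mk v w = mk v' w' -> v = v' /\ w = w'.
  by move=> eq_mk; have := congr1 (row 0) eq_mk; have := congr1 (row 1) eq_mk;
    rewrite !rowK.
have [PM0 PM1] : P 0 *m M = Q' 0 /\ P 1 *m M = Q' 1.
  by apply: mk_inj; rewrite -rowA mulKVmx.
have relP (Q0 : 'I_3 -> 'rV[K]_2) : cowedge Q0 0 *: Q0 0 + cowedge Q0 1 *: Q0 1
    + cowedge Q0 2%:R *: Q0 2%:R = 0.
  by apply/rowP => j; rewrite !mxE cowedge_rel.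
have PM2 : P 2%:R *m M = Q' 2%:R.
  have c2 := cow_ne Q' 2%:R Q'_ne.
  have eP i : cowedge Q' i *: P i = cowedge Q i *: Q i.
    by rewrite scalerA /e mulrC divfK // cow_ne.
  have := relP Q; rewrite -!eP => /(congr1 (mulmx^~ M)).
  have sP a i : (a *: P i) *m M = a *: (P i *m M) by rewrite -scalemxAl.
  rewrite mul0mx !mulmxDl !sP PM0 PM1 -[RHS](relP Q').
  by move/addrI/(scalerI c2).
have PM i : P i *m M = Q' i by have /or3P[] := ord3E i => /eqP->.
have [M0 defM] : exists M0 : 'M[k]_2, map_mx iota M0 = M.
  apply: absgal_fixed_mx => // s.
  have PsM i : P i *m map_mx s M = Q' i.
    have := congr1 (map_mx s) (PM ((rho s)^-1%g i)).
    have eE i0 : s (e i0) = e (rho s i0) by apply: cowedge_ratio_equivariant.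
    rewrite map_mxM map_mxZ eqQ eqQ' /= eE.
    by rewrite permKV.
  apply: (can_inj (mulKmx uA)); rewrite rowA !PsM /M mulKVmx //.
exists M0^T; first by rewrite unitmx_tr -(map_unitmx iota) defM unitmx_mul unitmx_inv uA.
by move=> i; rewrite trmxK defM -PM scalemxAl.
Qed.

(** Rescaling the frame of [x] by [D] and [D'] gives the transform of [x] by [h] the same Gram
    blocks as [y] has in its own frame, and the base changes between the frames descend. The last
    clause is for case (b), where one matrix must act on both sides. *)
Lemma framed_equiv x y L L' Q M M' Q' :
  framed J x L L' Q -> framed J y M M' Q' ->
  exists g1 g2 h, [/\ g1 \in unitmx, g2 \in unitmx, h \in unitmx,
    y = act_pair h (g1 *m x.1 *m g2^T, g1 *m x.2 *m g2^T)
    & D = D' -> L = L' -> M = M' -> g1 = g2].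
Proof.
move=> [[eqL eqL' eqQ] [uL uL'] Q_ne gramx] [[eqM eqM' eqQ'] [uM uM'] Q'_ne gramy].
have [h uh hE] := triple_transfer eqQ eqQ' Q_ne Q'_ne.
set e := fun i => cowedge Q i / cowedge Q' i in hE.
have eE s i : s (e i) = e (rho s i) by apply: cowedge_ratio_equivariant.
have e_ne i : e i != 0.
  have i12 : i + 1 != i + 2%:R by case: i => [[|[|[|]]]].
  by rewrite mulf_neq0 ?invr_eq0 ?Q_ne ?Q'_ne.
pose N i := D (e i) *m L i; pose N' i := D' (e i) *m L' i.
have eqN : equivariant rho N.
  by move=> s i; rewrite map_mxM (D_map s _).1 eE eqL.
have eqN' : equivariant rho N'.
  by move=> s i; rewrite map_mxM (D_map s _).2 eE eqL'.
have uN : stack N \in unitmx.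
  by apply: stack_scale_unit => // i; case: (D_unit (e_ne i)).
have uN' : stack N' \in unitmx.
  by apply: stack_scale_unit => // i; case: (D_unit (e_ne i)).
have [g1 defg1] := stack_descent eqM eqN uM.
have [g2 defg2] := stack_descent eqM' eqN' uM'.
exists g1, g2, h; split=> //.
- by rewrite -(map_unitmx iota) defg1 unitmx_mul unitmx_inv uM.
- by rewrite -(map_unitmx iota) defg2 unitmx_mul unitmx_inv uM'.
- pose z := act_pair h (g1 *m x.1 *m g2^T, g1 *m x.2 *m g2^T).
  suff eq_comp j : comp y j = comp z j.
    by rewrite [LHS]surjective_pairing -/z [z in RHS]surjective_pairing; congr pair;
      [apply: (eq_comp 0)|apply: (eq_comp 1)].
  apply: (@map_mx_inj _ _ iota).
  have -> : comp z j = g1 *m (h j 0 *: comp x 0 + h j 1 *: comp x 1) *m g2^T.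
    by move: j; apply: ord2P;
      rewrite /comp /act_pair /= mulmxDr mulmxDl -!scalemxAr -!scalemxAl.
  set X := _ + _; rewrite !map_mxM -map_trmx defg1 defg2.
  have uM'T : (stack M')^T \in unitmx by rewrite unitmx_tr.
  apply: (can_inj (mulKmx uM)); apply: (can_inj (mulmxK uM'T)).
  rewrite trmx_mul trmx_inv !mulmxA mulmxV // mul1mx mulmxKV //.
  apply: stack_eq => i l; rewrite gramy hE.
  have -> : N i *m map_mx iota X *m (N' l)^T
    = D (e i) *m (L i *m map_mx iota X *m (L' l)^T) *m (D' (e l))^T.
    by rewrite /N /N' trmx_mul !mulmxA.
  have -> : L i *m map_mx iota X *m (L' l)^T
    = ((i == l)%:R * (Q i *m map_mx iota h^T) 0 j) *: J.
    rewrite map_mxD !map_mxZ mulmxDr mulmxDl -!scalemxAr -!scalemxAl !gramx.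
    rewrite !scalerA -scalerDl; congr (_ *: _).
    rewrite !mxE !big_ord_recl big_ord0 /= !mxE.
    have -> : lift ord0 ord0 = 1 :> 'I_2 by apply: val_inj.
    by ring.
  rewrite -scalemxAr -scalemxAl; have [<-|] := eqVneq i l; last by rewrite !mul0r !scale0r.
  rewrite D_J scalerA -[cowedge Q i / _]/(e i); set q := Q i *m _.
  by rewrite [(_ *: q) 0 j]mxE !mul1r mulrC.
- move=> eqD eqLL' eqMM'; apply: (@map_mx_inj _ _ iota).
  by rewrite defg1 defg2 /N /N' eqD eqLL' eqMM'.
Qed.

End Equivalence.
End Frames.

(** Cutting [row_ebase] with [pid_mx d] gives a basis whose number of rows is [d] by typing, unlike
    [row_base], and both factors commute with field morphisms. *)
Lemma pid_row_ebase (K : fieldType) m n d (A : 'M[K]_(m, n)) :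
  \rank A = d -> ((pid_mx d : 'M_(d, n)) *m row_ebase A :=: A)%MS.
Proof. by move=> <-; apply: eq_row_base. Qed.

Definition ev (K : fieldType) n (X : 'I_2 -> 'M[K]_n) (v : 'rV[K]_2) : 'M[K]_n :=
  v 0 0 *: X 0 + v 0 1 *: X 1.

(** * Kernels of the singular members of the pencil *)

Section Kernels.
Variables (K : fieldType) (d : nat).
Local Notation n := (3 * d)%N.

(* The kernels of the three singular members of the pencil are eigenspaces,  *)
(* for distinct eigenvalues, of the quotient of two members of the pencil.   *)
Lemma stack_kernels_unit (X : 'I_2 -> 'M[K]_n) (p : 'I_3 -> 'rV[K]_2) v :
  (forall i j, i != j -> wedge (p i) (p j) != 0) ->
  (forall i, wedge v (p i) != 0) -> ev X v \in unitmx ->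
  (forall i, (\rank (ev X (p i)) <= 2 * d)%N) ->
  let U i : 'M_(d, n) := pid_mx d *m row_ebase (kermx (ev X (p i))) in
  stack U \in unitmx /\ forall i, U i *m ev X (p i) = 0.
Proof.
move=> p_ne v_ne uv rk U; set N := ev X v in uv.
pose T := ev X (p 0) *m invmx N.
(* The eigenvalue comes from writing [p i] as a combination of [v] and [p 0]: on the kernel at
   [p i], the member at [p 0] is a multiple of the member at [v]. *)
pose lam i := - wedge (p i) (p 0) / wedge v (p i).
have lam_inj : injective lam.
  move=> i j eq_lam; apply/eqP; apply: contraT => /p_ne; apply: contraNT => _.
  have : wedge (p i) (p 0) * wedge v (p j) = wedge (p j) (p 0) * wedge v (p i).
    have := eq_lam; rewrite /lam !mulNr => /oppr_inj/eqP.
    by rewrite eqr_div // => /eqP ->.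
  move=> eq_w; have : wedge v (p 0) * wedge (p i) (p j) = 0.
    rewrite -(subrr (wedge (p j) (p 0) * wedge v (p i))) -{1}eq_w /wedge; ring.
  by move/eqP; rewrite mulf_eq0 (negPf (v_ne 0)).
have ker_eig i : (kermx (ev X (p i)) <= eigenspace T (lam i))%MS.
  apply/eigenspaceP; rewrite /T mulmxA.
  have /sub_kermxP := submx_refl (kermx (ev X (p i))); set u := kermx _ => u0.
  have w0 := v_ne 0; have wi := v_ne i.
  have def_p : wedge v (p 0) *: ev X (p i) = wedge (p i) (p 0) *: N + wedge v (p i) *: ev X (p 0).
    have coord j : wedge v (p 0) * p i 0 j = wedge (p i) (p 0) * v 0 j + wedge v (p i) * p 0 0 j.
      by move: j; apply: ord2P; rewrite /wedge; ring.
    by rewrite /N /ev !scalerDr !scalerA !coord !scalerDl addrACA.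
  have /eqP : u *m (wedge v (p 0) *: ev X (p i)) = 0 by rewrite -scalemxAr u0 scaler0.
  rewrite def_p mulmxDr -!scalemxAr addrC addr_eq0 -scaleNr => /eqP eq_u.
  apply: (scalerI wi); rewrite scalerA /lam mulrC divfK // scalemxAl eq_u.
  by rewrite -scalemxAl mulmxK.
pose E i := eigenspace T (lam i).
have sumE : (\sum_i \rank (E i) <= n)%N.
  have /mxdirectP/= <- : mxdirect (\sum_i E i).
    by apply: mxdirect_sum_eigenspace => i j _ _; apply: lam_inj.
  exact: rank_leq_col.
have rkK i : (d <= \rank (kermx (ev X (p i))))%N.
  by rewrite mxrank_ker; have := rk i; lia.
have rkE i : (\rank (kermx (ev X (p i))) <= \rank (E i))%N by apply: mxrankS.
(* Three independent eigenspaces, each of dimension at least [d], in a space of dimension [3 * d]: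
   every inequality is an equality. *)
have rkE_eq i : \rank (E i) = d /\ \rank (kermx (ev X (p i))) = d.
  have ge j : (d <= \rank (E j))%N by apply: leq_trans (rkE j).
  have : (\rank (E i) <= d)%N.
    move: sumE; rewrite (bigD1 i) //=.
    have : (\sum_(j < 3 | j != i) d <= \sum_(j < 3 | j != i) \rank (E j))%N.
      by apply: leq_sum => j _.
    rewrite sum_nat_const (_ : #|_| = 2)%N; last first.
      by have := cardC1 i; rewrite card_ord.
    by move: (\sum_(_ < _ | _) _)%N (\rank _) => S r; lia.
  by have := ge i; have := rkE i; have := rkK i; lia.
have eqU i : (U i :=: kermx (ev X (p i)))%MS by apply: pid_row_ebase; case: (rkE_eq i).
split; last by move=> i; apply/sub_kermxP; rewrite eqU.
rewrite -row_full_unit -sub1mx.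
have subU i : (U i <= stack U)%MS.
  apply/row_subP => c.
  have -> : row c (U i) = row (mxvec_index i c) (stack U).
    by apply/rowP => b; rewrite [RHS]mxE stackE mxE.
  exact: row_sub.
have fullE : row_full (\sum_i E i)%MS.
  have /mxdirectP/= rkS : mxdirect (\sum_i E i).
    by apply: mxdirect_sum_eigenspace => i j _ _; apply: lam_inj.
  rewrite /row_full rkS (eq_bigr (fun=> d)) => [|i _]; last by case: (rkE_eq i).
  by rewrite sum_nat_const card_ord.
apply: submx_trans (_ : (1%:M <= \sum_i E i)%MS) _; first by rewrite sub1mx.
apply/sumsmx_subP => i _; apply: submx_trans (subU i); rewrite eqU.
have := ker_eig i => /mxrank_leqif_sup [_]; rewrite /E.
case: (rkE_eq i) => -> ->; rewrite eqxx => <- //.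
Qed.

(** The two matrices [U *m X j *m W^T] satisfy two linear relations, with coefficients [p] from the
    left kernel and [q] from the right one; their determinant is [wedge p q]. *)
Lemma pencil_gram_diag (X : 'I_2 -> 'M[K]_n) m m' (U : 'M[K]_(m, n)) (W : 'M[K]_(m', n)) p q :
  wedge p q != 0 -> U *m ev X p = 0 -> W *m (ev X q)^T = 0 ->
  forall j, U *m X j *m W^T = 0.
Proof.
move=> pq Up Wq.
have evE (q' : 'rV[K]_2) : q' 0 0 *: (U *m X 0 *m W^T) + q' 0 1 *: (U *m X 1 *m W^T) = U *m ev X q' *m W^T.
  by rewrite mulmxDr mulmxDl -!scalemxAr -!scalemxAl.
have e1 : p 0 0 *: (U *m X 0 *m W^T) + p 0 1 *: (U *m X 1 *m W^T) = 0.
  by rewrite evE Up mul0mx.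
have e2 : q 0 0 *: (U *m X 0 *m W^T) + q 0 1 *: (U *m X 1 *m W^T) = 0.
  rewrite evE -mulmxA.
  by rewrite -[ev X q]trmxK -trmx_mul Wq trmx0 mulmx0.
apply: ord2P; apply: (scalerI pq); rewrite scaler0.
  transitivity (q 0 1 *: (p 0 0 *: (U *m X 0 *m W^T) + p 0 1 *: (U *m X 1 *m W^T))
    - p 0 1 *: (q 0 0 *: (U *m X 0 *m W^T) + q 0 1 *: (U *m X 1 *m W^T))); last first.
    by rewrite e1 e2 !scaler0 subr0.
  by rewrite !scalerDr !scalerA opprD addrACA /wedge scalerBl
    [q 0 1 * p 0 1]mulrC subrr addr0 [q 0 1 * _]mulrC.
transitivity (p 0 0 *: (q 0 0 *: (U *m X 0 *m W^T) + q 0 1 *: (U *m X 1 *m W^T))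
  - q 0 0 *: (p 0 0 *: (U *m X 0 *m W^T) + p 0 1 *: (U *m X 1 *m W^T))); last first.
  by rewrite e1 e2 !scaler0 subr0.
by rewrite !scalerDr !scalerA opprD addrACA /wedge scalerBl
  [q 0 0 * p 0 0]mulrC subrr add0r [q 0 0 * _]mulrC.
Qed.

End Kernels.

Section FramedMarked.
Variables (k K : fieldType) (iota : {rmorphism k -> K}).
Hypothesis sepK : separable_closure iota.
Variable rho : absgal iota -> 'S_3.
Variables (d : nat) (J : 'M[K]_d).
Hypothesis uJ : J \in unitmx.
Variable c0 : 'I_d.
Local Notation n := (3 * d)%N.
Variable x : 'M[k]_n * 'M[k]_n.
Let X j := map_mx iota (comp x j).

Lemma kernels_equivariant (Y : 'I_2 -> 'M[k]_n) (p : 'I_3 -> 'rV[K]_2) :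
  equivariant rho p -> equivariant rho (fun i =>
    (pid_mx d : 'M_(d, n)) *m row_ebase (kermx (ev (fun j => map_mx iota (Y j)) (p i)))).
Proof.
move=> eqp s i; rewrite map_mxM map_pid_mx map_row_ebase map_kermx.
by rewrite /ev map_mxD !map_mxZ !absgal_map_iota -eqp !mxE.
Qed.

Lemma framed_of_kernels (U W : 'I_3 -> 'M[K]_(d, n)) (p : 'I_3 -> 'rV[K]_2) v c1 :
  equivariant rho U -> equivariant rho W -> stack U \in unitmx -> stack W \in unitmx ->
  (forall i j, i != j -> wedge (p i) (p j) != 0) ->
  (forall i, U i *m ev X (p i) = 0) -> (forall i, W i *m (ev X (p i))^T = 0) ->
  ev X v \in unitmx -> J c0 c1 = 1 ->
  (forall i j, exists a, U i *m X j *m (W i)^T = a *: J) ->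
  exists Q, framed rho J x U W Q.
Proof.
move=> eqU eqW uU uW p_ne Up Wp uv Jc shape.
(* The coefficient of [J] is read at a position where [J] has entry 1. *)
pose Q i : 'rV[K]_2 := \row_j (U i *m X j *m (W i)^T) c0 c1.
have QE i j : U i *m X j *m (W i)^T = Q i 0 j *: J.
  by have [a eq_a] := shape i j; rewrite mxE eq_a !mxE Jc mulr1.
have gram i l j : U i *m X j *m (W l)^T = ((i == l)%:R * Q i 0 j) *: J.
  have [<-|il] := eqVneq i l; first by rewrite mul1r QE.
  by rewrite mul0r scale0r (pencil_gram_diag (p_ne _ _ il) (Up i) (Wp l)).
have p0 i : p i != 0.
  by apply: (@wedge_neq0l _ _ (p (i + 1))); apply: p_ne; case: i => [[|[|[|]]]].
(* Otherwise the rows of [U i], multiplied by the invertible member at [v], would be orthogonal to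
   the whole basis [W] and hence zero. *)
have Q0 i : Q i != 0.
  apply/eqP => Qi0.
  have : U i *m ev X v *m (stack W)^T = 0.
    apply/matrixP => a b; rewrite -[b]mxvec_indexK; move: (split_index b) => [l c] /=.
    transitivity ((U i *m ev X v *m (W l)^T) a c).
      by rewrite [LHS]mxE [RHS]mxE; apply: eq_bigr => m _; rewrite [_^T _ _]mxE stackE [_^T _ _]mxE.
    rewrite /ev mulmxDr mulmxDl -!scalemxAr -!scalemxAl !gram Qi0 !mxE.
    by rewrite !mulr0 !mul0r !mulr0 addr0.
  move=> /(congr1 (fun M => M *m invmx (stack W)^T *m invmx (ev X v))).
  rewrite mulmxK ?unitmx_tr // mulmxK // !mul0mx => Ui0.
  have : row (mxvec_index i c0) (stack U) = 0.
    by apply/rowP => b; rewrite mxE stackE Ui0 !mxE.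
  move=> /(congr1 (mulmx^~ (invmx (stack U)))); rewrite -row_mul mulmxV // mul0mx.
  move=> /rowP/(_ (mxvec_index i c0)); rewrite !mxE eqxx => /eqP.
  by rewrite oner_eq0.
have Qp i : Q i 0 0 * p i 0 0 + Q i 0 1 * p i 0 1 = 0.
  have : U i *m ev X (p i) *m (W i)^T = 0 by rewrite Up mul0mx.
  rewrite /ev mulmxDr mulmxDl -!scalemxAr -!scalemxAl !QE !scalerA -scalerDl.
  move=> /matrixP/(_ c0 c1); rewrite 2!mxE Jc mulr1 [RHS]mxE => <-.
  by rewrite [p i 0 0 * _]mulrC [p i 0 1 * _]mulrC.
exists Q; split=> //.
- split=> // s i; apply/rowP => j; rewrite [LHS]mxE [Q i 0 j]mxE [RHS]mxE.
  have sX : map_mx s (X j) = X j by apply: absgal_map_iota.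
  by rewrite -(eqU s) -(eqW s) -[in RHS]sX map_trmx -!map_mxM [RHS]mxE.
move=> i j /p_ne; apply: contraNneq => Qij.
(* [Q l] vanishes on [p l], so it is proportional to [p l] turned by a right angle; proportional
   [Q i], [Q j] would then give proportional [p i], [p j]. *)
have perp l : wedge (Q l) (rv2 (- p l 0 1) (p l 0 0)) = 0.
  by rewrite /wedge !rv2E -[RHS](Qp l); ring.
have perp0 l : rv2 (- p l 0 1) (p l 0 0) != 0.
  by have := p0 l; rewrite !rv2_neq0 !rv2E oppr_eq0 orbC.
have : wedge (rv2 (- p i 0 1) (p i 0 0)) (rv2 (- p j 0 1) (p j 0 0)) = 0.
  apply: (@wedge0_trans _ _ (Q i)) => //; first by rewrite wedgeC perp oppr0.
  by apply: (@wedge0_trans _ _ (Q j)).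
by rewrite /wedge !rv2E => w0; rewrite -[X in _ == X]w0; apply/eqP; ring.
Qed.

Lemma framed_singular L L' Q v : framed rho J x L L' Q ->
  ((ev X v \in unitmx) = false <-> exists i, Q i 0 0 * v 0 0 + Q i 0 1 * v 0 1 = 0).
Proof.
move=> [_ [uL uL'] _ gram].
have gramv i l : L i *m ev X v *m (L' l)^T
    = ((i == l)%:R * (Q i 0 0 * v 0 0 + Q i 0 1 * v 0 1)) *: J.
  rewrite /ev mulmxDr mulmxDl -!scalemxAr -!scalemxAl !gram !scalerA -scalerDl.
  by congr (_ *: _); ring.
split=> [nuv|[i Qv]]; last first.
  apply/negP => uv.
  have : L i *m ev X v *m (stack L')^T = 0.
    apply/matrixP => a b; rewrite -[b]mxvec_indexK; move: (split_index b) => [l c] /=.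
    transitivity ((L i *m ev X v *m (L' l)^T) a c).
      by rewrite [LHS]mxE [RHS]mxE; apply: eq_bigr => m _; rewrite [_^T _ _]mxE stackE [_^T _ _]mxE.
    by rewrite gramv Qv mulr0 scale0r !mxE.
  move=> /(congr1 (fun M => M *m invmx (stack L')^T *m invmx (ev X v))).
  rewrite mulmxK ?unitmx_tr // mulmxK // !mul0mx => Li0.
  have : row (mxvec_index i c0) (stack L) = 0.
    by apply/rowP => b; rewrite mxE stackE Li0 !mxE.
  move=> /(congr1 (mulmx^~ (invmx (stack L)))); rewrite -row_mul mulmxV // mul0mx.
  move=> /rowP/(_ (mxvec_index i c0)); rewrite !mxE eqxx => /eqP.
  by rewrite oner_eq0.
apply: contrapT => nQ; move/negP: nuv; apply.
rewrite -row_free_unit; apply: inj_row_free => u uv0.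
pose t := u *m invmx (stack L).
have def_u : u = t *m stack L by rewrite mulmxKV.
have t0 l : row l (vec_mx t) = 0.
  have : u *m ev X v *m (L' l)^T = 0 by rewrite uv0 mul0mx.
  rewrite def_u mul_stack !mulmx_suml (bigD1 l) //= big1 ?addr0 => [|i il].
    rewrite -2!mulmxA [L l *m _]mulmxA gramv eqxx mul1r -scalemxAr => /eqP.
    rewrite scaler_eq0 => /orP[/eqP Qv|/eqP]; first by case: nQ; exists l.
    by move=> /(congr1 (mulmx^~ (invmx J))); rewrite mulmxK // mul0mx.
  by rewrite -2!mulmxA [L i *m _]mulmxA gramv (negPf il) mul0r scale0r mulmx0.
rewrite def_u (_ : t = 0) ?mul0mx // -[t]vec_mxK; apply/eqP; rewrite mxvec_eq0.
by apply/eqP/row_matrixP => l; rewrite t0 row0.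
Qed.

Lemma framed_marked F L L' Q : framed rho J x L L' Q ->
  (forall v, zero_form iota F v <-> (ev X v \in unitmx) = false) ->
  marked iota F (fun i => rv2 (Q i 0 1) (- Q i 0 0)) /\
  equivariant rho (fun i => rv2 (Q i 0 1) (- Q i 0 0)).
Proof.
move=> fr zeroE; have [[_ _ eqQ] _ Q_ne _] := fr; split; last first.
  by move=> s i; rewrite -eqQ; apply: rv2P; rewrite !mxE //= rmorphN.
split=> [i j /Q_ne|v v0].
  by congr (_ != 0); rewrite /wedge !rv2E; ring.
rewrite zeroE (framed_singular v fr); split=> -[i Qv]; exists i.
  by rewrite /wedge !rv2E -[RHS](oppr0) -Qv; ring.
by move: Qv; rewrite /wedge !rv2E -[RHS](oppr0) => Qv; apply: oppr_inj; rewrite -Qv; ring.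
Qed.

End FramedMarked.

(** * Alternating matrices in every characteristic *)

Section Alternating.

(** In characteristic 2 skew symmetry does not give a zero diagonal; the form T - T^T carries both
    conditions through congruences, sums and multiples. *)
Lemma alternatingP (R : comNzRingType) n (A : 'M[R]_n) :
  alternating A <-> exists T : 'M[R]_n, A = T - T^T.
Proof.
split=> [[AT A0]|[T ->]].
  exists (\matrix_(i, j) if (i < j)%N then A i j else 0).
  apply/matrixP => i j; rewrite !mxE.
  have Aji : A j i = - A i j by have /matrixP/(_ i j) := AT; rewrite !mxE.
  case: ltngtP => [_|_|/val_inj ->]; rewrite ?subr0 ?sub0r ?Aji ?opprK //.
by split=> [|i]; [rewrite linearB /= trmxK opprB|rewrite !mxE subrr].
Qed.

Lemma alternating_congr (R : comNzRingType) m n (A : 'M[R]_n) (B : 'M[R]_(m, n)) :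
  alternating A -> alternating (B *m A *m B^T).
Proof.
move=> /alternatingP[T ->]; apply/alternatingP; exists (B *m T *m B^T).
by rewrite mulmxBr mulmxBl !trmx_mul trmxK !mulmxA.
Qed.

Lemma alternatingZ (R : comNzRingType) n (a : R) (A : 'M[R]_n) :
  alternating A -> alternating (a *: A).
Proof.
move=> /alternatingP[T ->]; apply/alternatingP; exists (a *: T).
by apply/matrixP => i j; rewrite !mxE mulrBr.
Qed.

Lemma alternatingD (R : comNzRingType) n (A B : 'M[R]_n) :
  alternating A -> alternating B -> alternating (A + B).
Proof.
move=> /alternatingP[T ->] /alternatingP[S ->]; apply/alternatingP; exists (T + S).
by apply/matrixP => i j; rewrite !mxE opprD addrACA.
Qed.

Lemma alternating_map (R S : comNzRingType) (f : {rmorphism R -> S}) n (A : 'M[R]_n) :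
  alternating A -> alternating (map_mx f A).
Proof.
by move=> [AT A0]; split=> [|i]; rewrite ?mxE ?A0 ?rmorph0 // map_trmx AT map_mxN.
Qed.

Lemma alternating_map_inj (k K : fieldType) (f : {rmorphism k -> K}) n (A : 'M[k]_n) :
  alternating (map_mx f A) -> alternating A.
Proof.
move=> [AT A0]; split=> [|i].
  by apply: (@map_mx_inj _ _ f); rewrite -map_trmx AT map_mxN.
by apply: (fmorph_inj f); have := A0 i; rewrite mxE rmorph0.
Qed.

End Alternating.

(** * Pairs of matrices with a prescribed Galois action *)

Section Construction.
Variables (k K : fieldType) (iota : {rmorphism k -> K}).
Hypothesis sepK : separable_closure iota.
Variable rho : absgal iota -> 'S_3.
Hypothesis rho_hom : absgal_hom iota rho.

(* The plane of sum zero of the permutation module carries three coordinate   *)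
(* forms which are pairwise independent in every characteristic.              *)
Lemma ex_equivariant_triple :
  exists2 Q : 'I_3 -> 'rV[K]_2, equivariant rho Q
  & forall i j, i != j -> wedge (Q i) (Q j) != 0.
Proof.
have [L uL eqL] := equivariant_frame sepK rho_hom.
pose one : 'rV[K]_3 := const_mx 1.
(* Galois permutes the rows of [L], so their sum is invariant. *)
have [c defc] : exists c : 'rV[k]_3, map_mx iota c = one *m L.
  apply: absgal_fixed_mx => // s; rewrite map_mxM eqL row_permE mulmxA; congr (_ *m _).
  apply/rowP => j; rewrite !mxE (bigD1 ((rho s)^-1%g j)) //= big1 ?addr0.
    by rewrite !mxE rmorph1 mul1r permKV eqxx.
  move=> i; rewrite !mxE rmorph1 mul1r => neq_i.
  by rewrite -(inj_eq (@perm_inj _ (rho s)^-1%g)) permK (negPf neq_i).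
have rk_c : \rank (kermx c^T) = 2%N.
  rewrite mxrank_ker mxrank_tr -(mxrank_map iota) defc mxrankMfree; last first.
    by rewrite row_free_unit.
  have one_neq0 : one != 0 by apply/eqP => /rowP/(_ 0)/eqP; rewrite !mxE oner_eq0.
  by rewrite rank_rV one_neq0.
(* A rational basis of the plane orthogonal to [c], that is, of the twisted form of the plane of sum
   zero; the rows of [L *m BK] are its three coordinate forms. *)
pose B := pid_mx 2 *m row_ebase (kermx c^T) : 'M[k]_(2, 3).
have eqB := pid_row_ebase rk_c; rewrite -/B in eqB.
have cB : c *m B^T = 0.
  apply: trmx_inj; rewrite trmx_mul trmxK trmx0.
  by apply/sub_kermxP; rewrite eqB.
have freeB : row_free B by rewrite /row_free eqB rk_c.
pose BK := map_mx iota B^T; pose Q i := row i (L *m BK).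
have eqQ : equivariant rho Q.
  move=> s i; rewrite /Q map_row map_mxM absgal_map_iota eqL.
  by apply/rowP => j; rewrite !mxE; apply: eq_bigr => l _; rewrite !mxE.
exists Q => //.
have sumQ j : Q 0 0 j + Q 1 0 j + Q 2%:R 0 j = 0.
  have : one *m (L *m BK) = 0 by rewrite mulmxA -defc -map_mxM cB map_mx0.
  have QE i : Q i 0 j = (L *m BK) i j by rewrite mxE.
  move=> /rowP/(_ j); rewrite mxE [RHS]mxE !QE.
  under eq_bigr do rewrite [one _ _]mxE mul1r.
  rewrite !big_ord_recl big_ord0 addr0 addrA.
  have -> : lift ord0 ord0 = 1 :> 'I_3 by apply: val_inj.
  have -> : lift ord0 (lift ord0 ord0) = 2%:R :> 'I_3 by apply: val_inj.
  by [].
have injQ (y : 'cV[K]_2) : L *m BK *m y = 0 -> y = 0.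
  move=> /(congr1 (mulmx (invmx L))); rewrite -mulmxA mulKmx // mulmx0 => By.
  apply: trmx_inj; rewrite trmx0; apply: (@row_free_inj _ _ _ _ (map_mx iota B)).
    by rewrite row_free_map.
  by rewrite mul0mx; apply: trmx_inj; rewrite trmx_mul trmxK map_trmx By trmx0.
have Q2 j : Q 2%:R 0 j = - Q 0 0 j - Q 1 0 j.
  by apply: (addrI (Q 0 0 j + Q 1 0 j)); rewrite sumQ; ring.
have w12 : wedge (Q 1) (Q 2%:R) = wedge (Q 0) (Q 1) by rewrite /wedge !Q2; ring.
have w02 : wedge (Q 0) (Q 2%:R) = - wedge (Q 0) (Q 1) by rewrite /wedge !Q2; ring.
suff w01 : wedge (Q 0) (Q 1) != 0.
  move=> i j; have /or3P[] := ord3E i; have /or3P[] := ord3E j => /eqP-> /eqP-> // _;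
  by rewrite ?w12 ?w02 ?oppr_eq0 // wedgeC ?w12 ?w02 ?opprK ?oppr_eq0.
(* If all wedges vanished, each [Q i] turned by a right angle would be killed by the injective
   [L *m BK]; then [L *m BK] would be zero. *)
apply/eqP => w01; have w_all i j : wedge (Q i) (Q j) = 0.
  have /or3P[] := ord3E i; have /or3P[] := ord3E j => /eqP-> /eqP->;
  by rewrite ?wedgevv // ?w12 ?w02 ?w01 ?oppr0 // wedgeC ?w12 ?w02 ?w01 ?oppr0 ?opprK.
have Q_eq0 i : Q i = 0.
  have : (rv2 (Q i 0 1) (- Q i 0 0))^T = 0.
    apply: injQ; apply/matrixP => l z; rewrite [RHS]mxE -(w_all l i) [LHS]mxE.
    rewrite !big_ord_recl big_ord0 /wedge !mxE.
    have -> : lift ord0 ord0 = 1 :> 'I_2 by apply: val_inj.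
    by rewrite /=; ring.
  move=> /matrixP Qi; apply: rv2P; rewrite [RHS]mxE.
    by have := Qi 1 0; rewrite !mxE /= => /eqP; rewrite oppr_eq0 => /eqP.
  by have := Qi 0 0; rewrite !mxE.
have : (delta_mx 0 0 : 'cV[K]_2) = 0.
  apply: injQ; rewrite (_ : L *m BK = 0) ?mul0mx //.
  by apply/row_matrixP => i; rewrite [LHS]Q_eq0 row0.
by move=> /matrixP/(_ 0 0)/eqP; rewrite !mxE /= oner_eq0.
Qed.

Lemma ex_framed d (J : 'M[K]_d) : (forall s : absgal iota, map_mx s J = J) ->
  exists x L Q, framed rho J x L L Q /\
    (alternating J -> alternating x.1 /\ alternating x.2).
Proof.
move=> fixJ; have [Q eqQ Q_ne] := ex_equivariant_triple.
have [L3 uL3 eqL3] := equivariant_frame sepK rho_hom.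
(* The stack of these blocks is the Kronecker product of [L3] with the identity of size [d]. *)
pose L i : 'M[K]_(d, 3 * d) :=
  \matrix_(c, b) (L3 i (split_index b).1 * (c == (split_index b).2)%:R).
have eqL : equivariant rho L.
  move=> s i; apply/matrixP => c b; rewrite !mxE rmorphM rmorph_nat; congr (_ * _).
  by have /matrixP/(_ i (split_index b).1) := eqL3 s; rewrite !mxE.
have uL : stack L \in unitmx.
  rewrite -row_free_unit; apply: inj_row_free => t tL.
  have t0 : (vec_mx t)^T *m L3 = 0.
    apply/matrixP => c m; have /rowP/(_ (mxvec_index m c)) := tL.
    rewrite mul_stack summxE [RHS]mxE => tL0; rewrite [RHS]mxE -[RHS]tL0 mxE.
    apply: eq_bigr => i _; rewrite [RHS]mxE (bigD1 c) //= big1 ?addr0 => [|c' /negPf neq_c].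
      by rewrite !mxE split_indexK eqxx mulr1.
    by rewrite !mxE split_indexK neq_c !mulr0.
  rewrite -[t]vec_mxK -[vec_mx t]trmxK -[(vec_mx t)^T](mulmxK uL3) t0 mul0mx.
  by rewrite trmx0 linear0.
pose G j : 'M[K]_(3 * d) := \matrix_(a, b)
  (((split_index a).1 == (split_index b).1)%:R * Q (split_index a).1 0 j
    * J (split_index a).2 (split_index b).2).
pose X j := invmx (stack L) *m G j *m (invmx (stack L))^T.
have gram i l j : L i *m X j *m (L l)^T = ((i == l)%:R * Q i 0 j) *: J.
  apply/matrixP => c e; rewrite -stack_gram /X !mulmxA mulmxV // mul1mx.
  rewrite -mulmxA -trmx_mul mulmxV // trmx1 mulmx1.
  by rewrite !mxE !split_indexK.
have defX j : X j = invmx (stack L) *m G j *m (invmx (stack L))^T by [].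
clearbody X.
(* [X j] is determined by its Gram blocks in the frame, and Galois permutes frame and blocks by the
   same [rho s]. *)
have fixX j (s : absgal iota) : map_mx s (X j) = X j.
  apply: (stack_unit_eq uL uL) => i l; rewrite gram.
  have := congr1 (map_mx s) (gram ((rho s)^-1%g i) ((rho s)^-1%g l) j).
  rewrite !map_mxM -map_trmx !eqL !permKV map_mxZ fixJ => ->; congr (_ *: _).
  rewrite rmorphM rmorph_nat (inj_eq perm_inj); congr (_ * _).
  by have /matrixP/(_ 0 j) := eqQ s ((rho s)^-1%g i); rewrite permKV mxE.
have [x0 def_x0] := absgal_fixed_mx sepK (fixX 0).
have [x1 def_x1] := absgal_fixed_mx sepK (fixX 1).
have compE j : map_mx iota (comp (x0, x1) j) = X j by move: j; apply: ord2P.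
exists (x0, x1), L, Q; split.
  by split=> // i l j; rewrite compE gram.
move=> altJ.
have altG j : alternating (G j).
  have [JT J0] := altJ; split=> [|a]; last by rewrite mxE J0 mulr0.
  apply/matrixP => a b; rewrite !mxE eq_sym.
  have -> : J (split_index b).2 (split_index a).2 = - J (split_index a).2 (split_index b).2.
    by have /matrixP/(_ (split_index a).2 (split_index b).2) := JT; rewrite !mxE.
  by case: eqP => [->|_]; rewrite ?mul0r ?oppr0 // mulrN.
by split; apply: (@alternating_map_inj _ _ iota); rewrite /= ?def_x0 ?def_x1 defX;
  apply: alternating_congr.
Qed.

End Construction.

(** * Pfaffians *)

Lemma sum_perm_lift (V : nmodType) n (F : 'S_n.+1 -> V) :
  \sum_s F s = \sum_j \sum_(s : 'S_n) F (lift_perm ord0 j s).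
Proof.
rewrite pair_bigA /= (reindex (fun js : 'I_n.+1 * 'S_n => lift_perm ord0 js.1 js.2)) //=.
apply: onW_bij; apply: inj_card_bij.
  move=> [i s] [j t] /= eq_st.
  have eq_ij : i = j by have := congr1 (fun u : 'S_n.+1 => u ord0) eq_st; rewrite !lift_perm_id.
  rewrite eq_ij in eq_st *; congr pair; apply/permP => m; apply: (@lift_inj _ j).
  by have := congr1 (fun u : 'S_n.+1 => u (lift ord0 m)) eq_st; rewrite !lift_perm_lift.
by rewrite card_prod card_ord !card_Sn.
Qed.

Lemma even_odd_ordP n (a : 'I_n.*2) : exists m, a = even_ord m \/ a = odd_ord m.
Proof.
have lt_a : (a./2 < n)%N by rewrite -ltn_double -[X in (_ < X)%N]/(n.*2); have := ltn_ord a; lia.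
exists (Ordinal lt_a); have := odd_double_half a.
by case: (odd a) => def_a; [right|left]; apply: val_inj; rewrite /= -[LHS]def_a.
Qed.

Lemma even_ord0 n : @even_ord n.+1 ord0 = ord0.
Proof. exact: val_inj. Qed.

Lemma odd_ord0 n : @odd_ord n.+1 ord0 = lift ord0 ord0.
Proof. exact: val_inj. Qed.

Lemma even_ordS n m : @even_ord n.+1 (lift ord0 m) = lift ord0 (lift ord0 (even_ord m)).
Proof. by apply: val_inj; rewrite /= /bump /= !add1n doubleS. Qed.

Lemma odd_ordS n m : @odd_ord n.+1 (lift ord0 m) = lift ord0 (lift ord0 (odd_ord m)).
Proof. by apply: val_inj; rewrite /= /bump /= !add1n doubleS. Qed.

(** The least index 0 opens its pair and that pair comes first, so it sits in position 0; its
    partner [j] is free. This is the combinatorial part of the expansion along the first row. *)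
Lemma matching_perm_lift n i j (s : 'S_n.*2) :
  @matching_perm n.+1 (lift_perm ord0 i (lift_perm ord0 j s))
  = (i == ord0) && matching_perm s.
Proof.
set t : 'S_n.+1.*2 := lift_perm _ _ _.
have tE : t ord0 = i by rewrite /t lift_perm_id.
have tO : t (lift ord0 ord0) = lift i j by rewrite /t lift_perm_lift lift_perm_id.
have tS m : t (lift ord0 (lift ord0 m)) = lift i (lift j (s m)).
  by rewrite /t !lift_perm_lift.
have lt_lift p (h : 'I_p) a b : (lift h a < lift h b)%N = (a < b)%N.
  by rewrite !ltnNge /= leq_bump2.
have [i0|neq_i] := eqVneq i ord0; last first.
  apply/negP => /andP[/forallP lt_eo /forallP lt_ee].
  have [m [def_a|def_a]] := @even_odd_ordP n.+1 ((t^-1)%g ord0).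
    have t_m : t (even_ord m) = ord0 by rewrite -def_a permKV.
    have [m0|m_neq0] := eqVneq m ord0.
      by case/eqP: neq_i; rewrite -t_m m0 even_ord0 tE.
    have /forallP/(_ m)/implyP := lt_ee ord0.
    by rewrite t_m ltn0 lt0n => /(_ m_neq0).
  have t_m : t (odd_ord m) = ord0 by rewrite -def_a permKV.
  by have := lt_eo m; rewrite t_m ltn0.
rewrite /=; apply/andP/andP => -[/forallP lt_eo /forallP lt_ee]; split.
- by apply/forallP => m; have := lt_eo (lift ord0 m); rewrite even_ordS odd_ordS !tS !lt_lift.
- apply/forallP => m1; apply/forallP => m2; apply/implyP => lt_m.
  have /forallP/(_ (lift ord0 m2))/implyP := lt_ee (lift ord0 m1).
  by rewrite lt_lift !even_ordS !tS !lt_lift; apply.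
- apply/forallP => m; case: (unliftP ord0 m) => [m'|] ->.
    by rewrite even_ordS odd_ordS !tS !lt_lift.
  by rewrite even_ord0 odd_ord0 tE tO i0.
- apply/forallP => m1; apply/forallP => m2; apply/implyP.
  case: (unliftP ord0 m2) => [m2'|] -> //; rewrite even_ordS tS.
  case: (unliftP ord0 m1) => [m1'|] ->; last by rewrite even_ord0 tE i0.
  rewrite even_ordS tS !lt_lift => lt_m.
  by have /forallP/(_ m2')/implyP := lt_ee m1'; apply.
Qed.

Lemma pfaffian_expand (R : comNzRingType) n (A : 'M[R]_(n.*2.+2)) :
  @pfaffian R n.+1 A = \sum_(j < n.*2.+1) (-1) ^+ j * A ord0 (lift ord0 j) *
    @pfaffian R n (mxsub (fun m => lift ord0 (lift j m)) (fun m => lift ord0 (lift j m)) A).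
Proof.
rewrite /pfaffian big_mkcond /= sum_perm_lift (bigD1 ord0) //= [X in _ + X]big1 ?addr0.
  rewrite sum_perm_lift; apply: eq_bigr => j _.
  rewrite [in RHS]big_mkcond mulr_sumr; apply: eq_bigr => s _.
  rewrite matching_perm_lift eqxx /=; case: ifP => _; last by rewrite mulr0.
  rewrite !odd_lift_perm /= signr_addb signr_odd -!mulrA; congr (_ * _).
  rewrite big_ord_recl /= mulrCA; congr (_ * _).
    by rewrite even_ord0 odd_ord0 lift_perm_lift !lift_perm_id.
  congr (_ * _); apply: eq_bigr => m _; rewrite mxE even_ordS odd_ordS.
  by rewrite !lift_perm_lift.
move=> i neq_i; rewrite sum_perm_lift big1 // => j _; rewrite big1 // => s _.
by rewrite matching_perm_lift (negPf neq_i).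
Qed.

Section Pfaffian6.
Variable R : comNzRingType.

(** The Pfaffian on four indices; with natural numbers as indices, the identities in size six reduce
    by computation. *)
Definition pf4 (a : nat -> nat -> R) i j l m := a i j * a l m - a i l * a j m + a i m * a j l.

Lemma pfaffian6E (A : 'M[R]_6) : let a i j := A (inord i) (inord j) in
  @pfaffian R 3 A = a 0 1 * pf4 a 2 3 4 5 - a 0 2 * pf4 a 1 3 4 5
    + a 0 3 * pf4 a 1 2 4 5 - a 0 4 * pf4 a 1 2 3 5 + a 0 5 * pf4 a 1 2 3 4.
Proof.
move=> a; have aE (i j : 'I_6) : A i j = a i j by rewrite /a !inord_val.
have pf0 (B : 'M[R]_0) : @pfaffian R 0 B = 1.
  rewrite /pfaffian (bigD1 1%g) /=; last by apply/andP; split; apply/forallP => -[].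
  rewrite odd_perm1 big_ord0 mulr1 expr0 big1 ?addr0 //.
  by move=> s /andP[_ /eqP[]]; apply/permP => -[].
rewrite pfaffian_expand; do 5!rewrite [\sum_(_ < _) _]big_ord_recl; rewrite big_ord0.
rewrite !(pfaffian_expand, big_ord_recl, big_ord0, pf0, mxE) /= !aE /= /bump /= ?add0n ?add1n ?addn0.
rewrite /pf4 /=; ring.
Qed.
End Pfaffian6.

Section PfaffianRank.
Variable K : fieldType.

Section Adjugate.
Variable a : nat -> nat -> K.
Hypothesis aC : forall i j, a i j = - a j i.
Hypothesis a0 : forall i, a i i = 0.

Definition pf_minor i j :=
  let s := [seq m <- iota 0 6 | (m != i) && (m != j)] in
  pf4 a (nth 0%N s 0) (nth 0%N s 1) (nth 0%N s 2) (nth 0%N s 3).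

(** The Pfaffian analogue of the adjugate: complementary sub-Pfaffians, with signs that make it
    alternating. *)
Definition pf_adj i j : K :=
  if (i < j)%N then (-1) ^+ (i + j) * pf_minor i j
  else if (j < i)%N then (-1) ^+ (i + j).+1 * pf_minor i j else 0.

Definition pf6 := a 0 1 * pf4 a 2 3 4 5 - a 0 2 * pf4 a 1 3 4 5
  + a 0 3 * pf4 a 1 2 4 5 - a 0 4 * pf4 a 1 2 3 5 + a 0 5 * pf4 a 1 2 3 4.

Lemma mul_pf_adj i j : (i < 6)%N -> (j < 6)%N ->
  \sum_(m < 6) a i m * pf_adj m j = (i == j)%:R * pf6.
Proof.
(* Only the entries above the diagonal remain as variables, so each case becomes a polynomial
   identity. *)
have [u def_a] : exists u, a = fun i j => if (i < j)%N then u i j else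
    if (j < i)%N then - u j i else 0.
  exists a; apply/funext => m; apply/funext => n.
  by case: ltngtP => [//|_|->]; [apply: aC|apply: a0].
move=> lt_i lt_j; rewrite !big_ord_recl big_ord0 /= /bump /= !add1n /=.
case: i lt_i => [|[|[|[|[|[|i]]]]]] // _; case: j lt_j => [|[|[|[|[|[|j]]]]]] // _.
all: by rewrite /pf_adj /pf_minor /pf6 /pf4 def_a /=; ring.
Qed.

(** [pf4] is alternating in its indices, so a permutation changes at most the sign. The induction
    swaps adjacent blocks of the list. *)
Lemma pf4_perm s t : perm_eq s t -> size s = 4%N ->
  pf4 a (nth 0%N s 0) (nth 0%N s 1) (nth 0%N s 2) (nth 0%N s 3) = 0 ->
  pf4 a (nth 0%N t 0) (nth 0%N t 1) (nth 0%N t 2) (nth 0%N t 3) = 0.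
Proof.
pose P s := size s = 4%N -> pf4 a (nth 0%N s 0) (nth 0%N s 1) (nth 0%N s 2) (nth 0%N s 3) = 0.
move=> eq_st size_s s0.
suff : P t by apply; rewrite -(perm_size eq_st).
apply: (catCA_perm_ind _ eq_st) => // s1 s2 s3 P1 size_s'.
have := P1; rewrite /P !size_cat addnCA -!size_cat => /(_ size_s') {P1}.
move: size_s'; rewrite !size_cat.
case: s1 => [|x1 [|x2 [|x3 [|x4 [|x5 s1]]]]]; case: s2 => [|y1 [|y2 [|y3 [|y4 [|y5 s2]]]]];
case: s3 => [|z1 [|z2 [|z3 [|z4 [|z5 s3]]]]] //= _; rewrite /pf4 => pf0.
all: repeat match goal with |- context [a ?y ?x] =>
  match type of pf0 with context [a x y] => rewrite (aC y x) end end.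
all: first [by rewrite -[RHS]pf0; ring | by rewrite -[RHS]oppr0 -[in RHS]pf0; ring].
Qed.

Lemma pf4_repeat i j l : [/\ pf4 a i i j l = 0, pf4 a i j j l = 0 & pf4 a i j l l = 0].
Proof. by rewrite /pf4 !a0; split; ring. Qed.

(** A quadruple either repeats an index or, once sorted, is the complement of one of the fifteen
    pairs. *)
Lemma pf_minor_eq0 : (forall i j, (i < j < 6)%N -> pf_minor i j = 0) ->
  forall i j l m, (i < 6)%N -> (j < 6)%N -> (l < 6)%N -> (m < 6)%N -> pf4 a i j l m = 0.
Proof.
move=> minor0 i j l m lt_i lt_j lt_l lt_m.
have perm_s := permEl (perm_sort leq [:: i; j; l; m]).
apply: (@pf4_perm _ [:: i; j; l; m] perm_s); first by rewrite size_sort.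
have := sort_sorted leq_total [:: i; j; l; m].
have : all (fun x => (x < 6)%N) (sort leq [:: i; j; l; m]).
  by rewrite (perm_all _ perm_s) /= lt_i lt_j lt_l lt_m.
have : size (sort leq [:: i; j; l; m]) = 4%N by rewrite size_sort.
case: (sort _ _) => [|x1 [|x2 [|x3 [|x4 []]]]] //= _ /and5P[l1 l2 l3 l4 _] /and4P[x12 x23 x34 _].
have [->|n12] := eqVneq x1 x2; first by case: (pf4_repeat x2 x3 x4).
have [->|n23] := eqVneq x2 x3; first by case: (pf4_repeat x1 x3 x4).
have [->|n34] := eqVneq x3 x4; first by case: (pf4_repeat x1 x2 x4).
have {x12}n12 : (x1 < x2)%N by rewrite ltn_neqAle n12.
have {x23}n23 : (x2 < x3)%N by rewrite ltn_neqAle n23.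
have {x34}n34 : (x3 < x4)%N by rewrite ltn_neqAle n34.
move: minor0; rewrite /pf_minor => minor0 {perm_s}.
case: x1 n12 l1 => [|[|[|x1]]] n12 _; try lia.
all: case: x2 n23 n12 l2 => [|[|[|[|x2]]]] n23 n12 _; try lia.
all: case: x3 n34 n23 l3 => [|[|[|[|[|x3]]]]] n34 n23 _; try lia.
all: case: x4 n34 l4 => [|[|[|[|[|[|x4]]]]]] n34 l4; try lia.
all: first [exact: (minor0 0 1)%N | exact: (minor0 0 2)%N | exact: (minor0 0 3)%N
  | exact: (minor0 0 4)%N | exact: (minor0 0 5)%N | exact: (minor0 1 2)%N
  | exact: (minor0 1 3)%N | exact: (minor0 1 4)%N | exact: (minor0 1 5)%N
  | exact: (minor0 2 3)%N | exact: (minor0 2 4)%N | exact: (minor0 2 5)%N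
  | exact: (minor0 3 4)%N | exact: (minor0 3 5)%N | exact: (minor0 4 5)%N].
Qed.

End Adjugate.

(** If [U i 0 * V 0 j] is nonzero, the zero diagonal forces [V 0 i = 0]; then the entry at [(j, i)]
    vanishes, although it is minus the entry at [(i, j)]. *)
Lemma alternating_rank1 n r (U : 'M[K]_(n, r)) (V : 'M[K]_(r, n)) :
  (r <= 1)%N -> alternating (U *m V) -> U *m V = 0.
Proof.
case: r U V => [|[|//]] U V _ [UVT UV0]; first by rewrite thinmx0 mul0mx.
have UVE i j : (U *m V) i j = U i 0 * V 0 j by rewrite mxE big_ord1.
apply/matrixP => i j; rewrite [RHS]mxE; apply/eqP; apply: contraT.
rewrite UVE mulf_eq0 negb_or => /andP[Ui Vj].
have /eqP := UV0 i; rewrite UVE mulf_eq0 (negPf Ui) /= => /eqP Vi.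
have /matrixP/(_ j i) := UVT; rewrite [LHS]mxE [RHS]mxE !UVE Vi mulr0 => /eqP.
by rewrite oppr0 mulf_eq0 (negPf Ui) (negPf Vj).
Qed.

(** A zero Pfaffian must give a kernel of dimension 2. From [A *m B = 0] and rank at least 5, the
    alternating [B] has rank at most 1, so it is zero; then all sub-Pfaffians of size four vanish,
    which forces [A] to have rank at most 2. *)
Lemma pfaffian_rank (A : 'M[K]_6) : alternating A ->
  (@pfaffian K 3 A != 0 -> A \in unitmx) /\
  (@pfaffian K 3 A = 0 -> (\rank A <= 4)%N).
Proof.
move=> [AT A0]; pose a i j := A (inord i) (inord j).
have aC i j : a i j = - a j i by have /matrixP/(_ (inord j) (inord i)) := AT; rewrite !mxE.
have a0 i : a i i = 0 by apply: A0.
have AE (i j : 'I_6) : A i j = a i j by rewrite /a !inord_val.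
pose B : 'M[K]_6 := \matrix_(i, j) pf_adj a i j.
have AB : A *m B = (@pfaffian K 3 A)%:M.
  apply/matrixP => i j; rewrite !mxE.
  under eq_bigr do rewrite AE mxE.
  have -> : @pfaffian K 3 A = pf6 a by apply: pfaffian6E.
  by rewrite mul_pf_adj // mulr_natl.
split=> [pf0|pf0].
  have : A *m ((@pfaffian K 3 A)^-1 *: B) = 1%:M.
    by rewrite -scalemxAr AB scale_scalar_mx mulVf.
  by case/mulmx1_unit.
rewrite leqNgt; apply/negP => rkA.
have rkB : (\rank B <= 1)%N.
  have := @mulmx0_rank_max _ _ _ _ A B; rewrite AB pf0 raddf0 => /(_ erefl).
  by move: rkA; lia.
have altB : alternating B.
  split=> [|i]; last by rewrite mxE /pf_adj ltnn.
  apply/matrixP => i j; rewrite !mxE /pf_adj.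
  have minorC m l : pf_minor a m l = pf_minor a l m.
    by rewrite /pf_minor; under eq_filter do rewrite andbC.
  case: ltngtP => _; rewrite ?oppr0 // minorC addnC exprS ?mulN1r mulNr ?opprK //.
have B0 : B = 0.
  rewrite -(mulmx_base B); apply: alternating_rank1 => //.
  by rewrite mulmx_base.
have minor0 i j : (i < j < 6)%N -> pf_minor a i j = 0.
  move=> /andP[lt_ij lt_j].
  have /matrixP/(_ (inord i) (inord j)) := B0; rewrite !mxE /pf_adj.
  rewrite (inordK (ltn_trans lt_ij lt_j)) (inordK lt_j) lt_ij => /eqP.
  by rewrite mulf_eq0 signr_eq0 => /eqP.
have pf40 := pf_minor_eq0 aC a0 minor0.
have [A_eq0|] := eqVneq A 0; first by move: rkA; rewrite A_eq0 mxrank0.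
move=> A_neq0.
have [i [j Aij]] : exists i j, A i j != 0.
  apply: contrapT => nA; case/eqP: A_neq0; apply/matrixP => i j; rewrite [RHS]mxE.
  by apply/eqP; apply: contrapT => /negP Aij; apply: nA; exists i, j.
(* The vanishing of [pf4] at i, j, l, m says that A_ij A_lm = A_il A_jm - A_im A_jl, a factorisation
   through dimension 2. *)
pose U : 'M[K]_(6, 2) := \matrix_(l, c) if c == 0 then A i l else A j l.
pose V : 'M[K]_(2, 6) := \matrix_(c, m) if c == 0 then A j m else - A i m.
have def_A : A i j *: A = U *m V.
  apply/matrixP => l m; rewrite !mxE !big_ord_recl big_ord0 !mxE /=.
  have := pf40 i j l m (ltn_ord _) (ltn_ord _) (ltn_ord _) (ltn_ord _).
  rewrite /pf4 -!AE => /eqP; rewrite addr_eq0 subr_eq => /eqP ->; ring.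
have : (\rank A <= 2)%N.
  rewrite -(eqmx_scale A Aij) def_A; apply: leq_trans (mxrankM_maxl _ _) _.
  exact: rank_leq_col.
by move: rkA; lia.
Qed.

End PfaffianRank.

(** * Orbits *)

Section Forms.

Lemma map_pfaffian (R S : comNzRingType) (f : {rmorphism R -> S}) n (A : 'M[R]_n.*2) :
  @pfaffian S n (map_mx f A) = f (@pfaffian R n A).
Proof.
rewrite /pfaffian rmorph_sum; apply: eq_bigr => s _.
rewrite rmorphM rmorph_sign rmorph_prod; congr (_ * _).
by apply: eq_bigr => i _; rewrite mxE.
Qed.

Lemma pencil_homog (R : comNzRingType) n (x : 'M[R]_n * 'M[R]_n) i j :
  pencil x i j \is 1.-homog for mdeg.
Proof.
rewrite !mxE ![_ * _%:MP]mulrC !mul_mpolyC.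
by apply: dhomogD; apply: dhomogZ; rewrite dhomogX /= mdeg1.
Qed.

Lemma prod_homog (R : comNzRingType) n m (F : 'I_m -> {mpoly R[n]}) :
  (forall i, F i \is 1.-homog for mdeg) -> \prod_i F i \is m.-homog for mdeg.
Proof.
elim: m F => [|m IHm] F homF; first by rewrite big_ord0 dhomog1.
by rewrite big_ord_recl; apply: (@dhomogM _ _ _ 1 _ m) => //; apply: IHm.
Qed.

Lemma sign_homog (R : comNzRingType) n d (b : bool) (F : {mpoly R[n]}) :
  F \is d.-homog for mdeg -> (-1) ^+ b * F \is d.-homog for mdeg.
Proof. by rewrite mulr_sign; case: b => //; rewrite dhomogN. Qed.

Lemma form_a_homog (k : fieldType) (x : 'M[k]_3 * 'M[k]_3) :
  form_a x \is 3.-homog for mdeg.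
Proof.
apply: rpred_sum => s _; apply: sign_homog; apply: prod_homog => i.
exact: pencil_homog.
Qed.

Lemma form_b_homog (k : fieldType) (x : 'M[k]_6 * 'M[k]_6) :
  form_b x \is 3.-homog for mdeg.
Proof.
apply: rpred_sum => s _; apply: sign_homog; apply: prod_homog => i.
exact: pencil_homog.
Qed.

Variables (k K : fieldType) (iota : {rmorphism k -> K}).

Lemma map_pencil n (x : 'M[k]_n * 'M[k]_n) (v : 'rV[K]_2) :
  map_mx (meval (fun i => v ord0 i)) (map_mx (map_mpoly iota) (pencil x))
  = ev (fun j => map_mx iota (comp x j)) v.
Proof.
apply/matrixP => i j; rewrite !mxE !rmorphD !rmorphM /=.
by rewrite !map_mpolyX !mevalXU !map_mpolyC !mevalC.
Qed.

Lemma zero_form_a (x : 'M[k]_3 * 'M[k]_3) v :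
  zero_form iota (form_a x) v <-> (ev (fun j => map_mx iota (comp x j)) v \in unitmx) = false.
Proof.
rewrite /zero_form /form_a -!det_map_mx map_pencil unitmxE unitfE.
by split=> [->|/negbFE/eqP //]; rewrite eqxx.
Qed.

Lemma zero_form_b (x : 'M[k]_6 * 'M[k]_6) v :
  zero_form iota (form_b x) v <->
  @pfaffian K 3 (ev (fun j => map_mx iota (comp x j)) v) = 0.
Proof.
by rewrite /zero_form /form_b -(map_pfaffian (map_mpoly iota)) -(map_pfaffian (meval _)) map_pencil.
Qed.

End Forms.

Section Orbits.
Variable k : fieldType.

Lemma act_pair_mul n (g h : 'M[k]_2) (x : 'M[k]_n * 'M[k]_n) :
  act_pair g (act_pair h x) = act_pair (g *m h) x.
Proof.
rewrite /act_pair /= !mxE !big_ord_recl !big_ord0 !addr0.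
have -> : lift ord0 ord0 = 1 :> 'I_2 by apply: val_inj.
by rewrite !scalerDr !scalerA !scalerDl; congr pair; rewrite addrACA.
Qed.

Lemma act_pair_conj n (g1 g2 : 'M[k]_n) (h : 'M[k]_2) (x : 'M[k]_n * 'M[k]_n) :
  (g1 *m (act_pair h x).1 *m g2^T, g1 *m (act_pair h x).2 *m g2^T)
  = act_pair h (g1 *m x.1 *m g2^T, g1 *m x.2 *m g2^T).
Proof. by rewrite /act_pair /= !mulmxDr !mulmxDl -!scalemxAr -!scalemxAl. Qed.

Lemma act_pair1 n (x : 'M[k]_n * 'M[k]_n) : act_pair 1%:M x = x.
Proof.
by rewrite /act_pair !mxE /= !scale1r !scale0r addr0 add0r -surjective_pairing.
Qed.

Lemma act_aM g h x : act_a g (act_a h x) =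
  act_a (g.1.1 *m h.1.1, g.1.2 *m h.1.2, g.2 *m h.2) x :> 'M[k]_3 * 'M[k]_3.
Proof.
case: g h => [[g1 g2] g3] [[h1 h2] h3]; rewrite /act_a act_pair_conj act_pair_mul /=.
by rewrite !trmx_mul !mulmxA.
Qed.

Lemma orbit_a_refl (x : 'M[k]_3 * 'M[k]_3) : orbit_a x x.
Proof.
exists (1%:M, 1%:M, 1%:M); first by split; rewrite /GL /= unitmx1.
by rewrite /act_a act_pair1 trmx1 !mul1mx !mulmx1 -surjective_pairing.
Qed.

Lemma orbit_a_eq (x y : 'M[k]_3 * 'M[k]_3) : orbit_a x y -> orbit_a y x ->
  orbit_a x = orbit_a y.
Proof.
have sub (z w : 'M[k]_3 * 'M[k]_3) : orbit_a z w -> orbit_a w `<=` orbit_a z.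
  move=> [g [g1 g2 g3] <-] _ [h [h1 h2 h3] <-].
  exists (h.1.1 *m g.1.1, h.1.2 *m g.1.2, h.2 *m g.2); last by rewrite act_aM.
  by split; rewrite /GL /= unitmx_mul ?(g1, g2, g3) ?(h1, h2, h3).
by move=> xy yx; apply/seteqP; split; apply: sub.
Qed.

Lemma act_bM g h x : act_b g (act_b h x) =
  act_b (g.1 *m h.1, g.2 *m h.2) x :> 'M[k]_6 * 'M[k]_6.
Proof.
case: g h => [g1 g2] [h1 h2]; rewrite /act_b act_pair_conj act_pair_mul /=.
by rewrite !trmx_mul !mulmxA.
Qed.

Lemma orbit_b_refl (x : 'M[k]_6 * 'M[k]_6) : orbit_b x x.
Proof.
exists (1%:M, 1%:M); first by split; rewrite /GL /= unitmx1.
by rewrite /act_b act_pair1 trmx1 !mul1mx !mulmx1 -surjective_pairing.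
Qed.

Lemma orbit_b_eq (x y : 'M[k]_6 * 'M[k]_6) : orbit_b x y -> orbit_b y x ->
  orbit_b x = orbit_b y.
Proof.
have sub (z w : 'M[k]_6 * 'M[k]_6) : orbit_b z w -> orbit_b w `<=` orbit_b z.
  move=> [g [g1 g2] <-] _ [h [h1 h2] <-].
  exists (h.1 *m g.1, h.2 *m g.2); last by rewrite act_bM.
  by split; rewrite /GL /= unitmx_mul ?(g1, g2) ?(h1, h2).
by move=> xy yx; apply/seteqP; split; apply: sub.
Qed.

End Orbits.

Section Conclusion.
Variables (k K : fieldType) (iota : {rmorphism k -> K}).
Hypothesis sepK : separable_closure iota.
Let closedK : separably_closed K. Proof. by case: sepK. Qed.
Implicit Type rho : absgal iota -> 'S_3.

(** The deduction common to both cases, with [fr x rho] for the existence of a frame. Two orbits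
    with the same class share a [rho], hence a type of frame; a frame for [rho] also gives three
    distinct zeros, so the nonzero discriminant comes from the frame itself. *)
Lemma induces_bijection_of_frames (X : Type) (V D : set X) (orb : X -> set X)
    (form : X -> {mpoly k[2]}) (fr : X -> (absgal iota -> 'S_3) -> Prop) :
  (forall x, D x <-> V x /\ disc (form x) != 0) ->
  (forall x, form x \is 3.-homog for mdeg) ->
  (forall x rho, V x -> (gamma iota (form x) rho <-> fr x rho)) ->
  (forall x y rho, V x -> V y -> fr x rho -> fr y rho -> orb x = orb y) ->
  (forall x y rho, V x -> V y -> orb x = orb y -> fr x rho -> fr y rho) ->
  (forall rho, absgal_hom iota rho -> exists2 x, V x & fr x rho) ->
  induces_bijection D orb (fun x => gamma iota (form x)) (Ex3 iota).
Proof.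
move=> DE homF gammaE fr_orb orb_fr ex_fr.
have DV x : D x -> V x by case/DE.
have gamma_class x : D x ->
    exists2 rho, absgal_hom iota rho & gamma iota (form x) = hom_class rho.
  move=> /DE[_ disc0]; have [p mFp] := disc_marked sepK (homF x) disc0.
  exact: marked_gamma (homF x) _ mFp.
have gamma_orb x y : D x -> D y -> orb x = orb y ->
    gamma iota (form x) = gamma iota (form y).
  move=> /DV Vx /DV Vy eq_orb; apply/funext => rho; apply/propext.
  rewrite !gammaE //; split; first exact: orb_fr.
  exact: orb_fr (esym eq_orb).
(* The value [set0] is taken only outside the orbits of [D]. *)
pose f O := if pselect (exists2 x, D x & orb x = O) is left h
  then gamma iota (form (projT1 (cid2 h))) else set0.
have fE x : D x -> f (orb x) = gamma iota (form x).
  move=> Dx; rewrite /f; case: pselect => [h|[]]; last by exists x.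
  by case: cid2 => y Dy /= eq_orb; apply: gamma_orb.
exists f => //; split.
- move=> _ [x Dx <-]; rewrite fE //.
  by have [rho rho_hom ->] := gamma_class x Dx; exists rho.
- move=> _ _ /set_mem[x Dx <-] /set_mem[y Dy <-]; rewrite !fE // => eq_gamma.
  have [rho _ def_gamma] := gamma_class x Dx.
  have rho_x : gamma iota (form x) rho.
    by rewrite def_gamma; exists 1%g => //; apply/funext => s; rewrite conjg1.
  have rho_y : gamma iota (form y) rho by rewrite -eq_gamma.
  by apply: (@fr_orb x y rho); rewrite -?gammaE //; apply: DV.
- move=> _ [rho rho_hom <-]; have [x Vx fr_x] := ex_fr rho rho_hom.
  have gamma_rho : gamma iota (form x) rho by apply/gammaE.
  have [p mFp _] := (gammaP (homF x) rho).1 gamma_rho.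
  have Dx : D x by apply/DE; split=> //; apply: (marked_disc sepK (homF x) mFp).
  exists (orb x); first by exists x.
  have [rho1 _ def_gamma] := gamma_class x Dx.
  by rewrite fE // def_gamma; apply/esym/hom_class_eq; rewrite -def_gamma.
Qed.

Lemma gamma_vector rho F : F \is 3.-homog for mdeg -> gamma iota F rho ->
  exists p v, [/\ marked iota F p, equivariant rho p,
    forall i, wedge v (p i) != 0 & ~ zero_form iota F v].
Proof.
move=> homF /(gammaP homF)[p mFp eqp]; have [p_ne zeros] := mFp.
have [v v_ne] := fourth_point closedK p_ne; exists p, v; split=> //.
by move=> /zeros-/(_ (wedge_neq0l (v_ne 0)))[i /eqP]; rewrite (negPf (v_ne i)).
Qed.

Lemma ev_tr n (X : 'I_2 -> 'M[K]_n) v : ev (fun j => (X j)^T) v = (ev X v)^T.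
Proof. by apply/matrixP => i j; rewrite !mxE. Qed.

Definition framed_a (x : 'M[k]_3 * 'M[k]_3) rho : Prop :=
  exists L L' Q, @framed k K iota rho 1 1%:M x L L' Q.

Lemma gamma_framed_a x rho : gamma iota (form_a x) rho <-> framed_a x rho.
Proof.
split=> [/(gamma_vector (form_a_homog x))[p [v [mFp eqp v_ne nzv]]]|[L [L' [Q fr]]]].
  have [p_ne _] := mFp.
  pose X j := map_mx iota (comp x j).
  have uv : ev X v \in unitmx.
    by apply: contrapT => /negP/negbTE nuv; apply/nzv/zero_form_a.
  have rk i : (\rank (ev X (p i)) <= 2 * 1)%N.
    have /zero_form_a := marked_zero mFp i.
    rewrite -row_free_unit /row_free => /negbT rk3.
    have := rank_leq_row (ev X (p i)); rewrite leq_eqVlt (negPf rk3) /=.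
    by rewrite ltnS.
  have [uU Up] := @stack_kernels_unit K 1 X p v p_ne v_ne uv rk.
  (* The transposed pencil provides the right kernels. *)
  pose Y j := map_mx iota (comp x j)^T.
  have YE w : ev Y w = (ev X w)^T.
    by rewrite -ev_tr /ev /Y !map_trmx.
  have uvT : ev Y v \in unitmx by rewrite YE unitmx_tr.
  have rkT i : (\rank (ev Y (p i)) <= 2 * 1)%N by rewrite YE mxrank_tr.
  have [uW Wp] := @stack_kernels_unit K 1 Y p v p_ne v_ne uvT rkT.
  have [||||Q fr] := @framed_of_kernels k K iota rho 1 1%:M 0 x _ _ p v 0
    (@kernels_equivariant k K iota rho 1 (comp x) p eqp)
    (@kernels_equivariant k K iota rho 1 (fun j => (comp x j)^T) p eqp)
    uU uW p_ne Up.
  - by move=> i; rewrite -YE; apply: Wp.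
  - exact: uv.
  - by rewrite mxE.
  - suff scalar1 (M : 'M[K]_1) : exists a, M = a *: 1%:M by move=> i j; apply: scalar1.
    by exists (M 0 0); rewrite scalemx1 -mx11_scalar.
  by do 3!eexists; apply: fr.
apply/(gammaP (form_a_homog x)).
have [mF eqF] := @framed_marked k K iota rho 1 1%:M (unitmx1 _ _) 0 x (form_a x) L L' Q fr
  (zero_form_a iota x).
by eexists; [apply: mF|apply: eqF].
Qed.

Lemma framed_a_orbit x y rho : framed_a x rho -> framed_a y rho -> orbit_a x = orbit_a y.
Proof.
suff half z w : framed_a z rho -> framed_a w rho -> orbit_a z w.
  by move=> fx fy; apply: orbit_a_eq; apply: half.
move=> [L [L' [Q frz]]] [M [M' [Q' frw]]].
have [| | |g1 [g2 [h [ug1 ug2 uh -> _]]]] := @framed_equiv k K iota sepK rho 1 1%:M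
  (fun e => e%:M) (fun=> 1%:M) _ _ _ _ _ _ _ _ _ _ _ frz frw.
- by move=> e; rewrite trmx1 !mulmx1 scalemx1.
- move=> e e0; split; last exact: unitmx1.
  by rewrite unitmxE det_scalar unitfE expf_neq0.
- by move=> s e; rewrite map_scalar_mx map_mx1.
by exists (g1, g2, h).
Qed.

Lemma orbit_framed_a x y rho : orbit_a x = orbit_a y -> framed_a x rho -> framed_a y rho.
Proof.
move=> eq_orb [L [L' [Q fr]]].
have := orbit_a_refl y; rewrite -eq_orb => -[[[g1 g2] h] [/= ug1 ug2 uh] <-].
have fr' := @framed_act k K iota rho 1 _ x _ _ _ g1 g2 h ug1 ug2 uh fr.
by do 3!eexists; apply: fr'.
Qed.

Definition symplectic2 : 'M[K]_2 := \matrix_(i, j) ((i < j)%:R - (j < i)%:R).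

(** diag(e, 1): a congruence multiplies the symplectic form of the plane by the determinant, here
    [e]. *)
Definition partial_scalar (e : K) : 'M[K]_2 :=
  \matrix_(i, j) (if i == j then if i == 0 then e else 1 else 0).

Lemma mx2P (A B : 'M[K]_2) : A 0 0 = B 0 0 -> A 0 1 = B 0 1 -> A 1 0 = B 1 0 ->
  A 1 1 = B 1 1 -> A = B.
Proof.
by move=> *; apply/matrixP => i j; move: i j; apply: ord2P; apply: ord2P.
Qed.

Lemma symplectic2_unit : symplectic2 \in unitmx.
Proof.
rewrite unitmxE det2 !mxE /= (_ : _ - _ = 1) ?unitr1 //.
by ring.
Qed.

Lemma alternating_symplectic2 (A : 'M[K]_2) : alternating A <-> A = A 0 1 *: symplectic2.
Proof.
split=> [[AT A0]|->].
  have A10 : A 1 0 = - A 0 1 by have /matrixP/(_ 0 1) := AT; rewrite !mxE.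
  by apply: mx2P; rewrite !mxE /= ?A0 ?A10; ring.
split; last by move=> i; rewrite !mxE ltnn subrr mulr0.
by apply/matrixP => i j; rewrite !mxE; ring.
Qed.

Lemma partial_scalar_symplectic e :
  partial_scalar e *m symplectic2 *m (partial_scalar e)^T = e *: symplectic2.
Proof.
have l1 : lift ord0 ord0 = 1 :> 'I_2 by apply: val_inj.
by apply: mx2P; rewrite !mxE !big_ord_recl !big_ord0 !mxE !big_ord_recl !big_ord0 !mxE
  ?l1 /=; ring.
Qed.

Definition framed_b (x : 'M[k]_6 * 'M[k]_6) rho : Prop :=
  exists L Q, @framed k K iota rho 2 symplectic2 x L L Q.

(** Left and right kernels of an alternating matrix coincide, so one frame is enough; its diagonal
    blocks are alternating of size 2, hence multiples of [symplectic2]. *)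
Lemma gamma_framed_b x rho : V_b x -> (gamma iota (form_b x) rho <-> framed_b x rho).
Proof.
move=> [alt1 alt2]; pose X j := map_mx iota (comp x j).
have altX j : alternating (X j) by apply: alternating_map; move: j; apply: ord2P.
have alt_ev v : alternating (ev X v) by apply: alternatingD; apply: alternatingZ.
have zeroE v : zero_form iota (form_b x) v <-> (ev X v \in unitmx) = false.
  rewrite zero_form_b; have [pf_unit pf_rank] := pfaffian_rank (alt_ev v).
  split=> [/pf_rank rk4|nuv].
    rewrite -row_free_unit /row_free; apply/negP => /eqP rk6.
    by move: rk4; rewrite [\rank _]rk6.
  by apply/eqP; apply: contraFT nuv.
split=> [/(gamma_vector (form_b_homog x))[p [v [mFp eqp v_ne nzv]]]|[L [Q fr]]].
  have [p_ne _] := mFp.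
  have uv : ev X v \in unitmx.
    by apply: contrapT => /negP/negbTE nuv; apply/nzv/zeroE.
  have rk i : (\rank (ev X (p i)) <= 2 * 2)%N.
    have /zero_form_b := marked_zero mFp i.
    by case: (pfaffian_rank (alt_ev (p i))) => _; apply.
  have [uU Up] := @stack_kernels_unit K 2 X p v p_ne v_ne uv rk.
  have eqU := @kernels_equivariant k K iota rho 2 (comp x) p eqp.
  have [||||Q fr] := @framed_of_kernels k K iota rho 2 symplectic2 0 x _ _ p v 1
    eqU eqU uU uU p_ne Up.
  - by move=> i; case: (alt_ev (p i)) => -> _; rewrite mulmxN Up oppr0.
  - exact: uv.
  - by rewrite mxE /= subr0.
  - suff scalar2 (M : 'M[K]_2) : alternating M -> exists a, M = a *: symplectic2.
      by move=> i j; apply: scalar2; apply: alternating_congr; apply: altX.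
    by move=> altM; exists (M 0 1); apply/alternating_symplectic2.
  by do 2!eexists; apply: fr.
apply/(gammaP (form_b_homog x)).
have [mF eqF] := @framed_marked k K iota rho 2 symplectic2 symplectic2_unit 0 x (form_b x)
  L L Q fr zeroE.
by eexists; [apply: mF|apply: eqF].
Qed.

Lemma framed_b_orbit x y rho : framed_b x rho -> framed_b y rho -> orbit_b x = orbit_b y.
Proof.
suff half z w : framed_b z rho -> framed_b w rho -> orbit_b z w.
  by move=> fx fy; apply: orbit_b_eq; apply: half.
move=> [L [Q frz]] [M [Q' frw]].
have [| | |g1 [g2 [h [ug1 ug2 uh -> eq_g]]]] := @framed_equiv k K iota sepK rho 2 symplectic2
  partial_scalar partial_scalar _ _ _ _ _ _ _ _ _ _ _ frz frw.
- exact: partial_scalar_symplectic.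
- by move=> e e0; rewrite unitmxE det2 !mxE /= mulr1 mul0r subr0 unitfE.
- move=> s e; suff -> : map_mx s (partial_scalar e) = partial_scalar (s e) by [].
  by apply: mx2P; rewrite !mxE /= ?rmorph0 ?rmorph1.
by rewrite -(eq_g erefl erefl erefl); exists (g1, h).
Qed.

Lemma orbit_framed_b x y rho : orbit_b x = orbit_b y -> framed_b x rho -> framed_b y rho.
Proof.
move=> eq_orb [L [Q fr]].
have := orbit_b_refl y; rewrite -eq_orb => -[[g h] [/= ug uh] <-].
have fr' := @framed_act k K iota rho 2 _ x _ _ _ g g h ug ug uh fr.
by do 2!eexists; apply: fr'.
Qed.

End Conclusion.

Theorem theorem4p6 (k K : fieldType) (iota : {rmorphism k -> K}) :
  separable_closure iota ->
  induces_bijection (@Vss_a k) (@orbit_a k)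
    (fun x => gamma iota (form_a x)) (Ex3 iota) /\
  induces_bijection (@Vss_b k) (@orbit_b k)
    (fun x => gamma iota (form_b x)) (Ex3 iota).
Proof.
move=> sepK; split.
  apply: (@induces_bijection_of_frames k K iota sepK _ setT _ _ _ (@framed_a k K iota)).
  - by move=> x; split=> [|[]].
  - exact: form_a_homog.
  - by move=> x rho _; apply: gamma_framed_a.
  - by move=> x y rho _ _; apply: framed_a_orbit.
  - by move=> x y rho _ _; apply: orbit_framed_a.
  - move=> rho rho_hom.
    have [s|x [L [Q [fr _]]]] := ex_framed sepK rho_hom (J := 1%:M : 'M_1).
      by rewrite map_mx1.
    by exists x => //; exists L, L, Q.
apply: (@induces_bijection_of_frames k K iota sepK _ (@V_b k) _ _ _ (@framed_b k K iota)).
- by move=> x; split.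
- exact: form_b_homog.
- exact: gamma_framed_b.
- by move=> x y rho _ _; apply: framed_b_orbit.
- by move=> x y rho _ _; apply: orbit_framed_b.
- move=> rho rho_hom.
  have [s|x [L [Q [fr alt_x]]]] := ex_framed sepK rho_hom (J := symplectic2 K).
    by apply/matrixP => i j; rewrite !mxE rmorphB !rmorph_nat.
  exists x; last by exists L, Q.
  apply: alt_x; apply/alternating_symplectic2.
  by rewrite mxE /= subr0 scale1r.
Qed.
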